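(* Let $G$ be a subdivision of a graph $H$ such that each edge $vw\in E(H)$ is subdivided at least $$\lceil 10^{5}\log(\deg_H(v)+1)\rceil+\lceil 10^{5}\log(\deg_H(w)+1)\rceil+2$$ times in $G$. Then $\pi_{\mathrm{ch}}(G)\le 5$.
   Context: All graphs are simple, finite and undirected. All logarithms are binary (base $2$). A subdivision of a graph $H$ is a graph obtained from $H$ by replacing the edges of $H$ with internally disjoint paths, where the path replacing $vw$ has endpoints $v$ and $w$; the edge $vw$ is subdivided $s$ times if this path has $s$ internal vertices (division vertices). A path is even if its number of vertices is even. Given a vertex colouring $\psi$ of $G$, an even path $v_1,\dots,v_{2t}$ ($t\ge1$) of $G$ is repetitively coloured by $\psi$ if $\psi(v_i)=\psi(v_{t+i})$ for all $i\in\{1,\dots,t\}$. A colouring is nonrepetitive if no path of $G$ is repetitively coloured. A list assignment $L$ of $G$ assigns a set $L(v)$ of colours to each vertex $v$; $G$ is nonrepetitively $L$-colourable if it has a nonrepetitive colouring in which each vertex $v$ receives a colour in $L(v)$. $G$ is nonrepetitively $\ell$-choosable if it is nonrepetitively $L$-colourable for every list assignment $L$ with $|L(v)|\ge\ell$ for all $v\in V(G)$. The nonrepetitive choice number $\pi_{\mathrm{ch}}(G)$ is the minimum integer $\ell$ such that $G$ is nonrepetitively $\ell$-choosable. *)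

(* Defs.v *)
From HB Require Import structures.
From mathcomp Require Import all_boot all_order all_algebra.
From mathcomp Require Import all_classical all_reals all_analysis.

Set Implicit Arguments.
Unset Strict Implicit.
Unset Printing Implicit Defensive.

Import Order.TTheory GRing.Theory Num.Theory.

Local Open Scope classical_set_scope.
Local Open Scope card_scope.

Record sgraph := SGraph {
  vertex :> finType;
  adj : rel vertex;
  adj_sym : symmetric adj;
  adj_irrefl : irreflexive adj }.

Definition deg (G : sgraph) (v : G) : nat := #|[set w : G | adj v w]%SET|.

Definition is_path (G : sgraph) (p : seq G) : Prop :=
  uniq p /\ sorted (@adj G) p.

(* The default value [x0] of [nth] is irrelevant, all indices being in range. *)
Definition repetitively_coloured (G : sgraph) (C : Type) (psi : G -> C)
    (p : seq G) : Prop :=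
  exists t : nat, [/\ 0 < t, size p = t.*2 &
    forall (x0 : G) (i : nat), i < t ->
      psi (nth x0 p i) = psi (nth x0 p (t + i))].

Definition nonrepetitive (G : sgraph) (C : Type) (psi : G -> C) : Prop :=
  forall p : seq G, is_path p -> ~ repetitively_coloured psi p.

Definition nonrep_list_colourable (G : sgraph) (C : Type) (L : G -> set C)
    : Prop :=
  exists psi : G -> C, (forall v, L v (psi v)) /\ nonrepetitive psi.

(* Lists are arbitrary, possibly infinite, sets of colours; since `I_l is
   {0, ..., l - 1}, [`I_l #<= L v] says |L(v)| >= l. *)
Definition nonrep_choosable (G : sgraph) (l : nat) : Prop :=
  forall (C : Type) (L : G -> set C),
    (forall v, `I_l #<= L v) -> nonrep_list_colourable L.

Lemma inj_nonrepetitive (G : sgraph) (C : Type) (psi : G -> C) :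
  injective psi -> nonrepetitive psi.
Proof.
move=> inj p [up _] [t [t0 sp h]].
case: p up sp h => [|x p] up sp h; first by move: t0; rewrite -double_gt0 -sp.
have /inj/eqP := h x 0 t0.
rewrite nth_uniq // ?sp ?double_gt0 // addn0.
  by rewrite eq_sym eqn0Ngt t0.
by rewrite -addnn -[X in X < _]addn0 ltn_add2l.
Qed.

Lemma card_le_ord_inj (C : Type) (A : set C) (n : nat) :
  `I_n #<= A -> exists2 f : 'I_n -> C, injective f & forall i, A (f i).
Proof.
move=> /card_leP/unsquash f.
pose j (i : 'I_n) : set_type `I_n := exist _ (i : nat) (mem_set (ltn_ord i)).
exists (fun i => set_val (f (j i))) => [i k|i]; last exact: set_valP.
move=> /val_inj e; have /(congr1 set_val) : j i = j k.
  by apply: (@inj _ _ _ f) => //; rewrite inE.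
by move=> /= ik; apply: val_inj.
Qed.

Lemma fresh_colour (G : sgraph) (C : Type) (A : set C) (psi : G -> C)
    (s : seq G) :
  `I_#|G| #<= A -> size s < #|G| ->
  exists2 c, A c & forall u, u \in s -> psi u <> c.
Proof.
move=> /card_le_ord_inj[f finj fA] ss; apply: contrapT => nex.
have /choice[g gP] : forall i : 'I_#|G|, exists u, u \in s /\ psi u = f i.
  move=> i; apply: contrapT => ni; apply: nex; exists (f i) => //.
  by move=> u us e; apply: ni; exists u.
have ginj : injective g.
  by move=> i j e; apply: finj; rewrite -(gP i).2 -(gP j).2 e.
have : size (map g (enum 'I_#|G|)) <= size s.
  apply: uniq_leq_size; first by rewrite map_inj_uniq // enum_uniq.
  by move=> _ /mapP[i _ ->]; case: (gP i).
by rewrite size_map size_enum_ord leqNgt ss.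
Qed.

Lemma nonrep_choosable_card (G : sgraph) : nonrep_choosable G #|G|.
Proof.
move=> C L hL.
have /choice[psi0 psi0P] : forall v : G, exists c, L v c.
  move=> v; have v0 : 0 < #|G| by apply/card_gt0P; exists v.
  have [f _ fL] := card_le_ord_inj (hL v).
  by exists (f (Ordinal v0)).
have key (s : seq G) : uniq s -> exists psi : G -> C,
    (forall v, L v (psi v)) /\ {in s &, injective psi}.
  elim: s => [_|v s IH /= /andP[vs us]]; first by exists psi0.
  have [psi [psiL psiI]] := IH us.
  have ss : size s < #|G|.
    have uvs : uniq (v :: s) by rewrite /= vs.
    by have := max_card (mem (v :: s)); rewrite (card_uniqP uvs).
  have [c Lc cP] := fresh_colour psi (hL v) ss.
  exists (fun u => if u == v then c else psi u); split=> [u|x y].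
    by case: eqP => [->|_].
  rewrite !inE; case: (eqVneq x v) => [->|xv] /=;
    case: (eqVneq y v) => [->|yv] //= xs ys e.
  - by case: (cP _ ys).
  - by case: (cP _ xs).
  - exact: psiI.
have [psi [psiL psiI]] := key _ (enum_uniq G).
exists psi; split=> //; apply: inj_nonrepetitive => x y.
by apply: psiI; rewrite mem_enum.
Qed.

Lemma nonrep_choosable_ex (G : sgraph) :
  exists l : nat, `[< nonrep_choosable G l >].
Proof. by exists #|G|; apply/asboolP; exact: nonrep_choosable_card. Qed.

Definition pi_ch (G : sgraph) : nat := ex_minn (nonrep_choosable_ex G).

(* [division v w] lists, from v to w, the division vertices of the edge vw;
   its values on non-adjacent pairs are irrelevant.  An edge is traversed in
   both directions, [division w v] being the reversal of [division v w]. *)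
Record subdivision (H G : sgraph) := Subdivision {
  branch : H -> G;
  division : H -> H -> seq G;
  branch_inj : injective branch;
  division_rev : forall v w, adj v w -> division w v = rev (division v w);
  division_uniq : forall v w, adj v w -> uniq (division v w);
  division_branch : forall v w u, adj v w -> branch u \notin division v w;
  division_disjoint : forall v w v' w' x, adj v w -> adj v' w' ->
    x \in division v w -> x \in division v' w' ->
    (v' = v /\ w' = w) \/ (v' = w /\ w' = v);
  subdivision_vertex : forall x : G,
    (exists v, x = branch v) \/
    (exists v w, adj v w /\ x \in division v w);
  subdivision_edge : forall x y : G, adj x y <->
    exists v w, adj v w /\
      infix [:: x; y] (branch v :: rcons (division v w) (branch w)) }.

Definition log2 (R : realType) (x : R) : R := (ln x / ln 2)%R.

(* Main.v *)
Require Import Defs.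
From mathcomp Require Import all_boot all_order all_algebra.
From mathcomp Require Import all_classical all_reals all_analysis.
From mathcomp Require Import fintype finset zify ring lra.

Set Implicit Arguments.
Unset Strict Implicit.
Unset Printing Implicit Defensive.

Import Order.TTheory GRing.Theory Num.Theory.

(** Call a vertex of the subdivision [inner] if it is not a branch vertex.  Five
    colours are chosen from each list and each branch vertex receives the first of
    its own.  For a set [S] of inner vertices let [num S] be the number of
    nonrepetitive colourings of [S] and the branch vertices together.  The proof
    shows by induction on [S], in the manner of Rosenfeld, that colouring one more
    vertex [x] multiplies this number by a definite positive factor ([tip_step],
    [far_step]), so that [num] never vanishes ([num_gt0]).

    Of the colourings of [x |: S] obtained from those of [S] and a colour of [x],
    one must discard those with a repetition through [x].  A repetition on a path
    [P] is determined by the colours outside a half [U] of [P] ([card_bad]), and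
    by induction [S :\: U] has fewer colourings than [S] by the product of the
    factors of the vertices of [U].  It remains to compare the sum of these costs
    over all paths through [x] with the number of colours available for [x].

    Inside an edge, if the factors are at least 2 and [x] is a tip of the coloured
    part, then there is one path for each half-length [t] and the costs sum up to
    less than 2.  With four colours this leaves the factor 2, and with five colours
    almost 3.  If both neighbours of [x] are coloured, then there are [2 * t]
    paths of half-length [t]; with the factor 29/10 around [x] their costs still
    sum up to less than 5 ([sum_windows]), which leaves a small factor.  Such
    vertices are needed to close an edge, and to start uncolouring the middle of
    a coloured stretch.

    Branch vertices create many short paths.  Therefore the colour of [v] is
    forbidden within distance [rad v], proportional to the logarithm of the degree.
    This leaves four colours there, and a repetition through [v] must have
    half-length more than [rad v] ([bad_short]).  The number of paths
    of half-length [t] through branch vertices is then at most exponential in a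
    small multiple of [t] ([sum_walks], [path_weight_through]), whereas the cost of each is
    about [2 ^- t]; the total is negligible ([sum_minors]).  Near [v] the balance
    4 - 2 = 2 has no room even for a negligible term, except that the series of
    costs inside the edge is finite: the terms missing from it are of order
    [2 ^- (rad v)./2] at least, larger than the cost of the paths through [v].

    The edges are longer than the radii by a factor 500, so that the vertices near
    some branch vertex, which cannot always be uncoloured at a good rate, are a small
    fraction of any path that traverses an edge ([nfar_path]). *)

(** * Extending a partial colouring by one vertex *)

Section Counting.

Variables (G : sgraph) (C : Type) (f : G -> 'I_5 -> C).
Hypothesis f_inj : forall x, injective (f x).
Variables (al : G -> {set 'I_5}) (Br : {set G}).

Local Notation col := {ffun G -> 'I_5}.
Implicit Types (c : col) (S T U : {set G}) (x y : G) (p P : seq G).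

Definition paint c x := f x (c x).

(** A colour is an index into five colours chosen from each list, so that
    colourings form a finite type; [paint] gives the actual colour.  A partial
    colouring is a total function equal to [ord0] off its domain [S].  The
    vertices of [Br], outside [S], thus carry the fixed colour number [ord0], and
    a path may use them. *)
Definition good S : {set col} :=
  [set c : col | `[< [/\ forall x, x \notin S -> c x = ord0,
                   forall x, x \in S -> c x \in al x &
                   forall p, is_path p -> {subset p <= S :|: Br} ->
                     ~ repetitively_coloured (paint c) p] >]].

Lemma goodP S c : reflect
  [/\ forall x, x \notin S -> c x = ord0, forall x, x \in S -> c x \in al x &
      forall p, is_path p -> {subset p <= S :|: Br} ->
        ~ repetitively_coloured (paint c) p] (c \in good S).
Proof. by rewrite inE; exact: asboolP. Qed.

Definition restr T c : col := [ffun x => if x \in T then c x else ord0].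

Lemma nth_twin_mem (p : seq G) t i x0 : size p = t.*2 -> i < t ->
  nth x0 p i \in p /\ nth x0 p (t + i) \in p.
Proof. by move=> sp it; split; apply: mem_nth; rewrite sp; lia. Qed.

Lemma eq_repetitive c c' p :
  {in p, paint c =1 paint c'} ->
  repetitively_coloured (paint c) p -> repetitively_coloured (paint c') p.
Proof.
move=> e [t [t0 sp h]]; exists t; split => // x0 i it.
by have [m1 m2] := nth_twin_mem x0 sp it; rewrite -!e // h.
Qed.

(** Since the default index off the domain is also the colour of the vertices of
    [Br], erasing colours does not change the colours that paths may see. *)
Lemma restr_good S T c : [disjoint S & Br] -> T \subset S ->
  c \in good S -> restr T c \in good T.
Proof.
move=> SB TS /goodP[c0 cal cn]; apply/goodP; split.
- by move=> x xT; rewrite ffunE (negbTE xT).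
- by move=> x xT; rewrite ffunE xT cal // (subsetP TS).
move=> p pp pT rp; apply: (cn p pp).
  by move=> x /pT; rewrite !inE => /orP[/(subsetP TS) ->|->]; rewrite ?orbT.
apply: eq_repetitive rp => x /pT; rewrite !inE /paint ffunE.
case: ifP => // xT /= xB; rewrite c0 //; apply/negP => xS.
by have := disjointFr SB xS; rewrite xB.
Qed.

(** The candidates for a good colouring of [x |: S]: all that can fail is a
    repetition through [x]. *)
Definition ext_col S x : {set col} :=
  [set c : col | [&& restr S c \in good S, c x \in al x &
               [forall y, (y \notin x |: S) ==> (c y == ord0)]]].

Definition bad S x P : {set col} :=
  [set c : col in ext_col S x | `[< repetitively_coloured (paint c) P >]].

Lemma card_ext_col S x : x \notin S ->
  #|al x| * #|good S| <= #|ext_col S x|.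
Proof.
move=> xS; rewrite -cardsX.
pose h (u : 'I_5 * col) : col := [ffun y => if y == x then u.1 else u.2 y].
have hK : {in setX (al x) (good S), forall u, u.1 = h u x /\ u.2 = restr S (h u)}.
  move=> [a c]; rewrite in_setX /= => /andP[_ /goodP[c0 _ _]].
  split; first by rewrite ffunE eqxx.
  apply/ffunP => y; rewrite !ffunE.
  have [yS|/c0 ->//] := boolP (y \in S).
  by rewrite ifN //; apply: contraNneq xS => <-.
have hinj : {in setX (al x) (good S) &, injective h}.
  move=> u u' /hK[e1 e2] /hK[e1' e2'] e.
  by rewrite [u]surjective_pairing [u']surjective_pairing e1 e2 e1' e2' e.
rewrite -(card_in_imset hinj); apply/subset_leq_card/subsetP => c.
move=> /imsetP[u uX ->]; have [e1 e2] := hK _ uX.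
move: uX; rewrite [u]surjective_pairing in_setX /= => /andP[ua ug].
rewrite inE -surjective_pairing -e2 ug -e1 ua /=.
apply/forallP => y; apply/implyP; rewrite !inE negb_or => /andP[yx yS].
by rewrite ffunE (negbTE yx); move/goodP: ug => [-> //].
Qed.

Lemma repetitive_rev c p :
  repetitively_coloured (paint c) p -> repetitively_coloured (paint c) (rev p).
Proof.
move=> [t [t0 sp h]]; exists t; split=> // [|x0 i it]; first by rewrite size_rev.
rewrite !nth_rev ?sp; [|lia|lia].
have -> : t.*2 - i.+1 = t + (t - i.+1) by lia.
have -> : t.*2 - (t + i).+1 = t - i.+1 by lia.
by rewrite -h //; lia.
Qed.

(** Union bound over the repetitions through [x].  Listing each path in one of its
    two directions suffices, because a reversed repetition is a repetition; this
    halves the loss, which the numerical estimates cannot do without. *)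
Lemma card_good_step S x (F : seq (seq G)) : x \notin S ->
  (forall c p, c \in ext_col S x -> is_path p ->
     {subset p <= (x |: S) :|: Br} -> x \in p ->
     repetitively_coloured (paint c) p -> (p \in F) || (rev p \in F)) ->
  #|al x| * #|good S| <= #|good (x |: S)| + \sum_(P <- F) #|bad S x P|.
Proof.
move=> xS HF; apply: (leq_trans (card_ext_col xS)).
suff cov : ext_col S x \subset good (x |: S) :|: \bigcup_(P <- F) bad S x P.
  apply: (leq_trans (subset_leq_card cov)); apply: (leq_trans (leq_card_setU _ _)).
  rewrite leq_add2l; elim: F {HF cov} => [|P F IH]; first by rewrite !big_nil cards0.
  rewrite !big_cons; apply: (leq_trans (leq_card_setU _ _)).
  by rewrite leq_add2l.
apply/subsetP => c cE; rewrite inE; have [//|cg /=] := boolP (c \in good _).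
have [P PF rP] : exists2 P, P \in F & repetitively_coloured (paint c) P.
  apply: contrapT => nex; case/negP: cg; apply/goodP.
  move: (cE); rewrite inE => /and3P[/goodP[_ cal cn] cx /forallP c0]; split.
  - by move=> y yS; apply/eqP/(implyP (c0 y)).
  - move=> y; rewrite !inE; case: eqP => [->//|_ /= yS].
    by have := cal _ yS; rewrite ffunE yS.
  move=> p pp ps rp; have [xp|xp] := boolP (x \in p).
    have /orP[pF|pF] := HF c p cE pp ps xp rp; apply: nex; first by exists p.
    by exists (rev p) => //; exact: repetitive_rev.
  have psS : {subset p <= S :|: Br}.
    move=> y yp; have := ps y yp; rewrite !inE; case: eqP => // yx.
    by rewrite -yx yp in xp.
  apply: (cn p pp psS); apply: eq_repetitive rp => y yp; rewrite /paint ffunE.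
  case: ifP => // yS; congr (f y _).
  apply/eqP/(implyP (c0 y)); rewrite !inE yS orbF.
  by apply: contraNneq xp => <-.
rewrite big_tnth; move: PF => /seq_tnthP[i Pi].
apply/bigcupP; exists i => //; rewrite -Pi inE cE; exact/asboolP.
Qed.

(** [U] contains at most one vertex of each pair of partners on [P], so a
    repetition on [P] recovers the colours on [U] from those outside. *)
Definition transversal P U :=
  forall t i x0, size P = t.*2 -> i < t ->
    ~~ ((nth x0 P i \in U) && (nth x0 P (t + i) \in U)).

(** The vertex [u'] is the partner of [u], [t] positions before or after it. *)
Lemma twin P t u : size P = t.*2 -> u \in P -> exists2 u', u' \in P &
  (forall c, repetitively_coloured (paint c) P -> paint c u = paint c u') /\
  (forall U, transversal P U -> u \in U -> u' \notin U).
Proof.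
move=> sP uP; have iP := uP; rewrite -index_mem sP in iP.
have nu : nth u P (index u P) = u by rewrite nth_index.
have [lt|ge] := ltnP (index u P) t.
  exists (nth u P (t + index u P)); first by apply: mem_nth; rewrite sP; lia.
  split=> [c [s [s0 es h]]|U tU uU].
    have st : s = t by move: es; rewrite sP; lia.
    by rewrite -{1}nu h st.
  by have := tU t _ u sP lt; rewrite nu uU.
exists (nth u P (index u P - t)); first by apply: mem_nth; rewrite sP; lia.
have lt : index u P - t < t by lia.
have e : t + (index u P - t) = index u P by lia.
split=> [c [s [s0 es h]]|U tU uU].
  have st : s = t by move: es; rewrite sP; lia.
  by rewrite -{1}nu -{1}e -{1}st -h // st.
by have := tU t _ u sP lt; rewrite e nu uU andbT.
Qed.

Lemma bad_restr S x P U c : [disjoint S & Br] ->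
  c \in bad S x P -> restr (S :\: U) c \in good (S :\: U).
Proof.
move=> SB; rewrite inE => /andP[]; rewrite inE => /and3P[cg _ _] _.
have -> : restr (S :\: U) c = restr (S :\: U) (restr S c).
  by apply/ffunP => y; rewrite !ffunE !inE; case: (y \in S); rewrite ?andbF.
exact: (restr_good SB (subsetDl S U)).
Qed.

Lemma bad_inj S x P U c c' :
  {subset U <= P} -> {subset P <= (x |: S) :|: Br} -> transversal P U ->
  c \in bad S x P -> c' \in bad S x P -> (x \in U) || (c x == c' x) ->
  restr (S :\: U) c = restr (S :\: U) c' -> c = c'.
Proof.
move=> UP PS tU; rewrite !inE => /andP[/and3P[_ _ /forallP c0] /asboolP[t [t0 sP h]]].
move=> /andP[/and3P[_ _ /forallP c0'] /asboolP[t' [t0' sP' h']]] xU e.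
have off y : y \notin U -> c y = c' y.
  move=> yU; have [yx|yx] := eqVneq y x.
    by case/orP: xU => [xU|/eqP]; [rewrite yx xU in yU | rewrite yx].
  have [yS|yS] := boolP (y \in S).
    by have := congr1 (fun c : col => c y) e; rewrite !ffunE !inE yU yS.
  have yxS : y \notin x |: S by rewrite !inE negb_or yx.
  by rewrite (eqP (implyP (c0 y) yxS)) (eqP (implyP (c0' y) yxS)).
apply/ffunP => y; have [yU|] := boolP (y \in U); last exact: off.
have [y' y'P [hy tr]] := twin sP (UP y yU).
have y'U := tr U tU yU.
apply: (f_inj (x := y)); have := off _ y'U.
have -> : f y (c y) = paint c y' by apply: hy; exists t; split.
have -> : f y (c' y) = paint c' y' by apply: hy; exists t'; split.
by rewrite /paint => ->.
Qed.

(** A colouring that is repetitive on [P] can be reconstructed after its colours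
    on [U] are erased. *)
Lemma card_bad S x P U : [disjoint S & Br] ->
  {subset U <= P} -> {subset P <= (x |: S) :|: Br} -> transversal P U ->
  x \in U -> #|bad S x P| <= #|good (S :\: U)|.
Proof.
move=> SB UP PS tU xU.
have inj : {in bad S x P &, injective (restr (S :\: U))}.
  by move=> c c' cb cb'; apply: (bad_inj UP PS tU cb cb'); rewrite xU.
rewrite -(card_in_imset inj); apply/subset_leq_card/subsetP => _ /imsetP[c cb ->].
exact: bad_restr cb.
Qed.

(** If [x] is outside [U], its colour is the only other thing to remember. *)
Lemma card_bad5 S x P U : [disjoint S & Br] ->
  {subset U <= P} -> {subset P <= (x |: S) :|: Br} -> transversal P U ->
  #|bad S x P| <= 5 * #|good (S :\: U)|.
Proof.
move=> SB UP PS tU.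
pose h c := (c x, restr (S :\: U) c).
have inj : {in bad S x P &, injective h}.
  move=> c c' cb cb' [e1 e2]; apply: (bad_inj UP PS tU cb cb') e2.
  by rewrite e1 eqxx orbT.
have <- : #|[set: 'I_5]| * #|good (S :\: U)| = 5 * #|good (S :\: U)|.
  by rewrite cardsT card_ord.
rewrite -cardsX -(card_in_imset inj).
apply/subset_leq_card/subsetP => _ /imsetP[c cb ->].
by rewrite in_setX in_setT (bad_restr _ SB cb).
Qed.

Lemma card_good_le5 S x : [disjoint S & Br] ->
  #|good S| <= 5 * #|good (S :\ x)|.
Proof.
move=> SB; pose h c := (c x, restr (S :\ x) c).
have inj : {in good S &, injective h}.
  move=> c c' /goodP[c0 _ _] /goodP[c0' _ _] [e1 e2]; apply/ffunP => y.
  have [->//|yx] := eqVneq y x; have [yS|yS] := boolP (y \in S).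
    by have := congr1 (fun c : col => c y) e2; rewrite !ffunE !inE yx yS.
  by rewrite c0 // c0'.
have <- : #|[set: 'I_5]| * #|good (S :\ x)| = 5 * #|good (S :\ x)|.
  by rewrite cardsT card_ord.
rewrite -cardsX -(card_in_imset inj).
apply/subset_leq_card/subsetP => _ /imsetP[c cb ->].
by rewrite in_setX in_setT /= (restr_good SB) // subsetDl.
Qed.

End Counting.

(** * Numerical estimates *)

Section Numeric.
Local Open Scope ring_scope.
Variable R : realFieldType.

Lemma pow3_base : 24 * (4 * 50 + 3) * 2 ^+ 15 * 2 ^+ 50 <= 3 ^+ 50 :> R.
Proof.
(* 3 ^ 7 > 2 ^ 11, hence 3 ^ 49 >= 2 ^ 77 *)
have h7 : 2 ^+ 11 <= 3 ^+ 7 :> R.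
  have : (2 ^ 11)%:R <= (3 ^ 7)%:R :> R by rewrite ler_nat; vm_compute.
  by rewrite !natrX.
have h1 : 24 * (4 * 50 + 3) <= 3 * 2 ^+ 12 :> R.
  have : (24 * (4 * 50 + 3))%:R <= (3 * 2 ^ 12)%:R :> R by rewrite ler_nat; vm_compute.
  by rewrite (natrM _ 3) (natrX _ 2 12) (natrM _ 24) natrD natrM.
have gen (a b : R) : 0 < a -> a ^+ 11 <= b ^+ 7 -> 24 * (4 * 50 + 3) <= b * a ^+ 12 -> 0 < b ->
    24 * (4 * 50 + 3) * a ^+ 15 * a ^+ 50 <= b ^+ 50.
  move=> a0 ab h b0.
  have h49 : a ^+ (11 * 7) <= b ^+ (7 * 7).
    rewrite (exprM a 11 7) (exprM b 7 7).
    by apply: (lerXn2r 7 _ _ ab); rewrite nnegrE exprn_ge0 // ltW.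
  have -> : 50%N = (7 * 7).+1 by [].
  rewrite [b ^+ _]exprS; apply: (@le_trans _ _ (b * a ^+ (11 * 7))); last by rewrite ler_pM2l.
  have -> : (11 * 7 = 12 + (15 + (7 * 7).+1))%N by [].
  rewrite -mulrA -(exprD a 15) (exprD a 12) (mulrA b) ler_pM2r //.
  by rewrite exprn_gt0.
by apply: gen.
Qed.

Lemma pow3_step q : (50 <= q)%N ->
  24 * (4 * q%:R + 3) * 2 ^+ 15 * 2 ^+ q <= 3 ^+ q :> R.
Proof.
elim: q => // q IH; rewrite leq_eqVlt => /predU1P[<-|/ltnSE q50]; first exact: pow3_base.
have {}IH := IH q50; rewrite (exprS 3) (exprS 2 q) -(natr1 q).
apply: (@le_trans _ _ (3 * (24 * (4 * q%:R + 3) * 2 ^+ 15 * 2 ^+ q))); last by rewrite ler_pM2l.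
have p0 : 0 < 2 ^+ 15 * 2 ^+ q :> R by rewrite mulr_gt0 // exprn_gt0.
have -> : 24 * (4 * (q%:R + 1) + 3) * 2 ^+ 15 * (2 * 2 ^+ q) =
   (2 * (24 * (4 * (q%:R + 1) + 3))) * (2 ^+ 15 * 2 ^+ q) :> R by ring.
have -> : 3 * (24 * (4 * q%:R + 3) * 2 ^+ 15 * 2 ^+ q) =
   (3 * (24 * (4 * q%:R + 3))) * (2 ^+ 15 * 2 ^+ q) :> R by ring.
rewrite ler_pM2r //.
have : 50%:R <= q%:R :> R by rewrite ler_nat.
lra.
Qed.

(** The left side is what a repetition of half-length [t] through branch vertices
    may cost beyond the factor [2 ^- t], see [minor_pow]; this bound turns the cost
    into a geometric series of ratio 2/3. *)
Lemma pow_bound t k : (200 < t)%N -> (4 * k <= t)%N ->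
  24 * t%:R * 2 ^+ (15 + k) <= (4 / 3) ^+ t :> R.
Proof.
move=> t200 kt; have te := divn_eq t 4; set q := (t %/ 4)%N in te.
have rl : (t %% 4 < 4)%N by rewrite ltn_mod.
have q50 : (50 <= q)%N by rewrite /q; lia.
apply: (le_trans _ (_ : 3 ^+ q <= _)); last first.
  apply: (@le_trans _ _ ((4 / 3) ^+ (4 * q))).
    by rewrite exprM lerXn2r // ?nnegrE; lra.
  by apply: ler_weXn2l; [lra|rewrite te; lia].
apply: le_trans (pow3_step q50).
rewrite exprD mulrA ler_pM ?mulr_ge0 ?exprn_ge0 //.
  rewrite ler_pM2r ?exprn_gt0 // ler_pM2l //.
  rewrite -[4]/(4%:R) -natrM -[3]/(3%:R) -natrD ler_nat; lia.
by apply: ler_weXn2l; [rewrite ler1n|rewrite /q; lia].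
Qed.

Lemma pow23 : (2 / 3) ^+ 201 <= 1 / 100 :> R.
Proof.
apply: (@le_trans _ _ ((2 / 3) ^+ 12)).
  by apply: ler_wiXn2l; [lra|lra|].
by rewrite !exprS expr0; lra.
Qed.

(** As 4/9 < 1/2, the paths through a branch vertex are paid for by the slack
    [2 * 2 ^- h] of [sum_half]. *)
Lemma pow23_half h m : (h.*2 <= m)%N -> (2 / 3) ^+ m <= 2 ^- h :> R.
Proof.
move=> hm; apply: (@le_trans _ _ ((2 / 3) ^+ (h.*2))).
  by apply: ler_wiXn2l => //; lra.
rewrite -mul2n exprM -exprVn; apply: lerXn2r; rewrite ?nnegrE; lra.
Qed.

(** The growth rate to be claimed for each vertex of a window of [t] consecutive
    vertices around a deep vertex: for [t <= 8] the whole window is far. *)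
Definition window_rate t : R := if (t <= 8)%N then 29 / 10 else 2.

Lemma window_rate_gt0 t : 0 < window_rate t.
Proof. by rewrite /window_rate; case: ifP => _; lra. Qed.

(** There are [2 * t] intervals of [2 * t] vertices through a given vertex, and their
    total cost stays below the five available colours.  With the rate 29/10
    throughout, the series is 2 / (1 - 10/29)^2 = 1682/361; the terms beyond 8 add
    at most 10/64.  Both sums telescope. *)
Lemma sum_windows T :
  \sum_(t <- iota 1 (8 + T)) t.*2%:R * window_rate t ^- t.-1 <= 241 / 50 :> R.
Proof.
pose b : R := 10 / 29.
(* both correction terms are the tails of the corresponding infinite series *)
have h1 m : (m <= 8)%N -> \sum_(t <- iota 1 m) t.*2%:R * window_rate t ^- t.-1 +
    (58 / 19 * (m%:R + 1) + 580 / 361) * b ^+ m = 1682 / 361 :> R.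
  elim: m => [_|m IH m8]; first by rewrite big_nil expr0; lra.
  rewrite -(IH (ltnW m8)) -(addn1 m) iotaD big_cat /= big_seq1 add1n addn1 /window_rate m8 /=.
  rewrite -addrA; congr (_ + _); rewrite -exprVn (_ : (29 / 10)^-1 = b); last by rewrite /b; field.
  rewrite exprS -mul2n natrM -(natr1 m) {2}/b; by field.
have h2 m : \sum_(t <- iota 9 m) t.*2%:R * window_rate t ^- t.-1 +
    (m%:R + 10) * 4 * 2^-1 ^+ (8 + m) = 10 * 4 * 2^-1 ^+ 8 :> R.
  elim: m => [|m IH]; first by rewrite big_nil !add0r addn0.
  rewrite -IH -(addn1 m) iotaD big_cat /= big_seq1 -addrA; congr (_ + _).
  have -> : window_rate (9 + m) = 2 by [].
  have -> : (9 + m).-1 = (8 + m)%N by [].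
  have -> : (8 + (m + 1) = (8 + m).+1)%N by rewrite addnA addn1.
  have -> : (9 + m).*2%:R = 2 * (m%:R + 9) :> R by rewrite -mul2n natrM natrD addrC.
  rewrite -exprVn (exprS _ (8 + m)) natrD; move: (2^-1 ^+ (8 + m)) => y; by field.
rewrite iotaD big_cat /= -/(iota 1 8); have := h1 8%N isT; have := h2 T.
have p1 : 0 <= (58 / 19 * (8%:R + 1) + 580 / 361) * b ^+ 8 :> R.
  apply: mulr_ge0; first by clear; lra.
  by apply: exprn_ge0; rewrite /b; clear; lra.
have p2 : 0 <= (T%:R + 10) * 4 * 2^-1 ^+ (8 + T) :> R.
  have T0 := ler0n R T; apply: mulr_ge0; first by clear - T0; lra.
  by apply: exprn_ge0; clear; lra.
have p3 : 10 * 4 * 2^-1 ^+ 8 = 10 / 64 :> R by rewrite !exprS expr0; field.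
rewrite p3; lra.
Qed.

Lemma far_rate m : (m <= 8)%N -> 10 * (50 / 29) ^+ m <= 2 ^+ 10 :> R.
Proof.
move=> m8; apply: (@le_trans _ _ (10 * (50 / 29) ^+ 8)).
  by rewrite ler_wpM2l // ?ler0n //; apply: ler_weXn2l => //; lra.
have h : (50 / 29) ^+ 2 <= 3 :> R by rewrite expr2; lra.
have {}h : (50 / 29) ^+ (2 * 4) <= 81 :> R.
  apply: (@le_trans _ _ (3 ^+ 4)).
    by rewrite exprM; apply: lerXn2r; rewrite ?nnegrE ?exprn_ge0; lra.
  by rewrite -natrX ler_nat.
apply: (@le_trans _ _ (10 * 81)); first by rewrite ler_wpM2l // ler0n.
by rewrite -natrM -natrX ler_nat.
Qed.

End Numeric.

(** * Paths of a subdivision *)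

(** Locked, so that conversion never unfolds it into a unary numeral. *)
Definition stretch : nat := locked (1000 * 100).

Lemma stretchE : stretch = 1000 * 100. Proof. by rewrite /stretch -lock. Qed.

Section Subdivision.

Variables (H G : sgraph) (D : subdivision H G).

Implicit Types (u v w : H) (x y z : G) (p q l P : seq G) (i j k n m t : nat) (S T U : {set G}).

Definition len v w := size (division D v w).

Definition edge_seq v w := branch D v :: rcons (division D v w) (branch D w).

(** The vertices of the subdivided edge [v w], numbered from [branch D v] at 0 to
    [branch D w] at [(len v w).+1]. *)
Definition vtx v w j : G := nth (branch D v) (edge_seq v w) j.

Definition Br : {set G} := [set x : G | [exists v, x == branch D v]].

Definition seg v w i n := [seq vtx v w k | k <- iota i n].

Lemma BrP x : reflect (exists v, x = branch D v) (x \in Br).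
Proof.
by rewrite inE; apply: (iffP existsP) => -[v] => [/eqP|] e; exists v; rewrite ?e.
Qed.

Lemma branch_Br v : branch D v \in Br. Proof. by apply/BrP; exists v. Qed.

Lemma size_edge_seq v w : size (edge_seq v w) = (len v w).+2.
Proof. by rewrite /= size_rcons. Qed.

Lemma len_sym v w : adj v w -> len w v = len v w.
Proof. by move=> vw; rewrite /len (division_rev D vw) size_rev. Qed.

Lemma vtx0 v w : vtx v w 0 = branch D v. Proof. by []. Qed.

Lemma vtx_last v w : vtx v w (len v w).+1 = branch D w.
Proof. by rewrite /vtx /= nth_rcons ltnn eqxx. Qed.

Lemma vtx_division v w j : 0 < j <= len v w -> vtx v w j \in division D v w.
Proof.
by case: j => //= j jl; rewrite /vtx /= nth_rcons jl mem_nth.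
Qed.

Lemma edge_seq_sym v w : adj v w -> edge_seq w v = rev (edge_seq v w).
Proof.
by move=> vw; rewrite /edge_seq (division_rev D vw) rev_cons rev_rcons.
Qed.

Lemma vtx_sym v w j : adj v w -> j <= (len v w).+1 ->
  vtx w v j = vtx v w ((len v w).+1 - j).
Proof.
move=> vw jl; rewrite /vtx edge_seq_sym // nth_rev ?size_edge_seq //.
by rewrite subSS; apply: set_nth_default; rewrite size_edge_seq; lia.
Qed.

Lemma vtx_rev v w j : adj v w -> j <= (len v w).+1 ->
  vtx v w j = vtx w v ((len v w).+1 - j).
Proof.
move=> vw jl; rewrite (vtx_sym vw); last by lia.
by congr vtx; lia.
Qed.

Lemma adj_neq v w : adj v w -> v != w.
Proof. by apply: contraTneq => ->; rewrite adj_irrefl. Qed.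

Lemma uniq_edge_seq v w : adj v w -> uniq (edge_seq v w).
Proof.
move=> vw; rewrite /= mem_rcons rcons_uniq inE negb_or (division_uniq D vw).
rewrite !(division_branch D _ vw) !andbT.
by apply: contraNneq (adj_neq vw) => /branch_inj ->.
Qed.

Lemma vtx_inj v w i j : adj v w -> i <= (len v w).+1 -> j <= (len v w).+1 ->
  vtx v w i = vtx v w j -> i = j.
Proof.
move=> vw il jl /eqP; rewrite /vtx nth_uniq ?size_edge_seq //; last exact: uniq_edge_seq.
by move/eqP.
Qed.

Lemma vtx_inner v w j : adj v w -> 0 < j <= len v w -> vtx v w j \notin Br.
Proof.
move=> vw jl; apply/BrP => -[u e]; have := vtx_division jl.
by rewrite e (negbTE (division_branch D u vw)).
Qed.

Lemma vtx_innerP v w j : adj v w -> j <= (len v w).+1 -> vtx v w j \notin Br -> 0 < j <= len v w.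
Proof.
move=> vw jl; case: j jl => [|j] jl; first by rewrite vtx0 branch_Br.
rewrite ltnS leq_eqVlt in jl; case/predU1P: jl => [->|//].
by rewrite vtx_last branch_Br.
Qed.

Lemma vtx_eq v w v' w' i j : adj v w -> adj v' w' -> 0 < i <= len v w ->
  j <= (len v' w').+1 -> vtx v w i = vtx v' w' j ->
  [/\ v' = v, w' = w & j = i] \/ [/\ v' = w, w' = v & j = (len v w).+1 - i].
Proof.
move=> vw vw' il jl e; have jl' : 0 < j <= len v' w'.
  by apply: (vtx_innerP vw') => //; rewrite -e; exact: vtx_inner.
have di := vtx_division il; have dj := vtx_division jl'; rewrite -e in dj.
have [[ev ew]|[ev ew]] := division_disjoint vw vw' di dj; subst v' w'; [left|right].
  by split=> //; apply: (vtx_inj vw _ _ (esym e)) => //; lia.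
split=> //; rewrite len_sym // in jl.
by move: e; rewrite (vtx_sym vw) // => e; have := vtx_inj vw _ _ e; lia.
Qed.

Lemma adj_vtx x y : adj x y ->
  exists v w j, [/\ adj v w, j <= len v w, x = vtx v w j & y = vtx v w j.+1].
Proof.
move=> /(subdivision_edge D)[v [w [vw /infixP[p [s e]]]]].
have sz := congr1 size e; rewrite size_edge_seq !size_cat /= in sz.
exists v, w, (size p); split => //.
- by rewrite -2!ltnS sz !addnS !ltnS leq_addr.
- by rewrite /vtx /edge_seq e nth_cat ltnn subnn.
by rewrite /vtx /edge_seq e nth_cat ltnNge leqnSn /= subSnn.
Qed.

Lemma nbr_vtx v w j y : adj v w -> 0 < j <= len v w -> adj (vtx v w j) y ->
  y = vtx v w j.-1 \/ y = vtx v w j.+1.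
Proof.
move=> vw jl /adj_vtx[v' [w' [i [vw' il e ->]]]].
have [|[ev ew ei]|[ev ew ei]] := vtx_eq vw vw' jl _ e; first by lia.
  by subst; right.
subst v' w' i; left; rewrite len_sym // in il; rewrite (vtx_sym vw); last by lia.
by congr vtx; lia.
Qed.

Lemma nbr_branch v y : adj (branch D v) y ->
  exists w, adj v w /\ y = vtx v w 1.
Proof.
move=> /adj_vtx[v' [w [j [vw jl e ->]]]]; exists w.
have j0 : j = 0.
  apply/eqP; rewrite -leqn0 leqNgt; apply/negP => j0.
  by have /negP[] := vtx_inner vw (introT andP (conj j0 jl)); rewrite -e branch_Br.
by move: e vw; rewrite j0 vtx0 => /branch_inj ->.
Qed.

Lemma vertexE x : x \notin Br ->
  exists v w j, [/\ adj v w, 0 < j <= len v w & x = vtx v w j].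
Proof.
move=> xB; have [[v e]|[v [w [vw xd]]]] := subdivision_vertex D x.
  by case/BrP: xB; exists v.
exists v, w, (index x (division D v w)).+1; split=> //.
  by rewrite index_mem.
by rewrite /vtx /= nth_rcons index_mem xd nth_index.
Qed.

Lemma size_seg v w i n : size (seg v w i n) = n.
Proof. by rewrite size_map size_iota. Qed.

Lemma nth_seg x0 v w i n k : k < n -> nth x0 (seg v w i n) k = vtx v w (i + k).
Proof. by move=> kn; rewrite (nth_map 0) ?size_iota // nth_iota. Qed.

Lemma seg_cat v w i n m : seg v w i (n + m) = seg v w i n ++ seg v w (i + n) m.
Proof. by rewrite /seg iotaD map_cat. Qed.

Lemma mem_seg x v w i n :
  reflect (exists2 k, i <= k < i + n & x = vtx v w k) (x \in seg v w i n).
Proof.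
apply: (iffP mapP) => -[k]; rewrite ?mem_iota => kn e; exists k => //.
by rewrite mem_iota.
Qed.

Lemma rev_seg v w i n : adj v w -> i + n <= (len v w).+2 ->
  rev (seg v w i n) = seg w v ((len v w).+2 - (i + n)) n.
Proof.
move=> vw il; apply: (@eq_from_nth _ (branch D v)); first by rewrite size_rev !size_seg.
move=> k; rewrite size_rev size_seg => kn; rewrite nth_rev ?size_seg // !nth_seg //; last by lia.
by rewrite (vtx_sym vw); [congr vtx|]; lia.
Qed.

Lemma uniq_seg v w i n : adj v w -> i + n <= (len v w).+2 -> uniq (seg v w i n).
Proof.
move=> vw il; rewrite map_inj_in_uniq ?iota_uniq // => a b; rewrite !mem_iota => al bl.
by apply: vtx_inj => //; lia.
Qed.

Lemma first_branch p : has (mem Br) p -> exists q v r,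
  p = q ++ branch D v :: r /\ forall y, y \in q -> y \notin Br.
Proof.
elim: p => //= x p IH; have [/BrP[v ->] _|xB /= /IH[q [v [r [-> nb]]]]] := boolP (x \in Br).
  by exists [::], v, p.
by exists (x :: q), v, r; split=> // y; rewrite inE => /predU1P[->|/nb].
Qed.

(** Inside an edge a path can only go on or turn back, so a path that avoids the
    branch vertices is an interval of one edge. *)
Lemma branch_free_path p : p != [::] -> is_path p -> (forall x, x \in p -> x \notin Br) ->
  exists v w i, [/\ adj v w, 0 < i, i + size p <= (len v w).+1 & p = seg v w i (size p)].
Proof.
elim: p => // x [|y p] IH _ [up sp] nb.
  have [|v [w [j [vw jl ->]]]] := @vertexE x; first by apply: nb; rewrite inE.
  by exists v, w, j; split=> //=; lia.
have [|||v [w [i [vw i0 il e]]]] := IH.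
- by [].
- by split; [case/andP: up | case/andP: sp].
- by move=> z zp; apply: nb; rewrite inE zp orbT.
have xB : x \notin Br by apply: nb; rewrite inE eqxx.
have yE : y = vtx v w i by case: e.
have yx : adj (vtx v w i) x by rewrite -yE adj_sym; case/andP: sp.
have il' : 0 < i <= len v w by rewrite /= in il; lia.
have [xe|xe] := nbr_vtx vw il' yx.
  have jl : 0 < i.-1 <= len v w by apply: (vtx_innerP vw); rewrite -?xe //; lia.
  exists v, w, i.-1; rewrite /= in il *; split=> //; [lia|lia|].
  have -> : x :: y :: p = vtx v w i.-1 :: seg v w i (size p).+1 by rewrite -e -xe.
  by rewrite /seg /= (prednK i0).
case: p {IH sp nb} up e il => [|z p] up e il.
  have jl : 0 < i.+1 <= len v w by apply: (vtx_innerP vw); rewrite -?xe //; lia.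
  have e2 : [:: x; y] = seg w v ((len v w).+2 - (i + 2)) 2.
    by rewrite -rev_seg //= ?xe ?yE //; lia.
  rewrite e2 size_seg; exists w, v, ((len v w).+2 - (i + 2)).
  have wv : adj w v by rewrite adj_sym.
  rewrite (len_sym vw); split=> //; lia.
case: e => _ ze _; move: up; rewrite xe /= !inE ze /=.
by rewrite eqxx !orbT.
Qed.

Lemma path_in_edge v w j p : adj v w -> 0 < j <= len v w -> is_path p ->
  (forall x, x \in p -> x \notin Br) -> vtx v w j \in p ->
  exists i, [/\ 0 < i, i + size p <= (len v w).+1, i <= j < i + size p &
    p = seg v w i (size p) \/ rev p = seg v w i (size p)].
Proof.
move=> vw jl pp nb jp; have p0 : p != [::] by apply: contraTneq jp => ->.
have [v' [w' [i [vw' i0 il e]]]] := branch_free_path p0 pp nb.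
move: jp; rewrite {1}e => /mem_seg[k kl ek].
have kl' : k <= (len v' w').+1 by clear - kl il; lia.
have [[ev ew ej]|[ev ew ej]] := vtx_eq vw vw' jl kl' ek; subst v' w' k.
  by exists i; split=> //; left.
have il2 : i + size p <= (len w v).+2 by apply: leqW.
have er : rev p = seg v w ((len w v).+2 - (i + size p)) (size p).
  by rewrite {1}e (rev_seg vw' il2).
have ls := len_sym vw; exists ((len w v).+2 - (i + size p)).
split; [| | |by right]; clear - il kl jl i0 ls; lia.
Qed.

(** * Near and far vertices *)

Variable lam : H -> nat.
Hypothesis lam_gt0 : forall v, 0 < lam v.
Hypothesis edges_long : forall v w, adj v w -> stretch * (lam v + lam w) <= len v w.
Hypothesis deg_lam : forall v, deg v <= 4 ^ lam v.

(** In the application [lam v] is about [log2 (deg v + 1)].  The constant 200 makes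
    repetitions longer than [rad v] so rare that they outweigh the branching at [v]
    even against the slack 2^(- rad v / 2) available near [v]; it is small enough
    compared with [stretch] for near vertices to be scarce on long paths. *)
Definition rad v := 200 * lam v.

Definition near v x := [exists w, adj v w && (x \in seg v w 1 (rad v))].

Definition far x := (x \notin Br) && ~~ [exists v, near v x].

(** Branch vertices count as not far. *)
Definition nfar p := count (predC far) p.

(** The logarithm, in base 4, of a bound on the number of ways to continue a path
    at [x]. *)
Definition weight x := if [pick v | x == branch D v] is Some v then lam v else 0.

Definition path_weight p := \sum_(x <- p) weight x.

Lemma long v w : adj v w -> 1000 * 100 * (lam v + lam w) <= len v w.
Proof. by rewrite -stretchE; exact: edges_long. Qed.

Lemma len_gt0 v w : adj v w -> 0 < len v w.
Proof. by move=> /long; have := lam_gt0 v; lia. Qed.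

Lemma weight_branch v : weight (branch D v) = lam v.
Proof.
rewrite /weight; case: pickP => [w /eqP/branch_inj -> //|/(_ v)].
by rewrite eqxx.
Qed.

Lemma weight_inner x : x \notin Br -> weight x = 0.
Proof.
move=> xB; rewrite /weight; case: pickP => // v /eqP e.
by rewrite e branch_Br in xB.
Qed.

Lemma path_weight_nil : path_weight [::] = 0. Proof. exact: big_nil. Qed.

Lemma path_weight_cons x p : path_weight (x :: p) = weight x + path_weight p.
Proof. exact: big_cons. Qed.

Lemma path_weight_cat p q : path_weight (p ++ q) = path_weight p + path_weight q.
Proof. exact: big_cat. Qed.

Lemma path_weight_rev p : path_weight (rev p) = path_weight p.
Proof. by apply: perm_big; rewrite perm_rev. Qed.

Lemma seg_inner v w i n x : adj v w -> 0 < i -> i + n <= (len v w).+1 ->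
  x \in seg v w i n -> x \notin Br.
Proof. by move=> vw i0 il /mem_seg[k kl ->]; apply: vtx_inner; lia. Qed.

Lemma path_weight_inner p : (forall x, x \in p -> x \notin Br) -> path_weight p = 0.
Proof. by move=> h; apply: big1_seq => x /andP[_ /h]; exact: weight_inner. Qed.

Lemma nearP u v w j : adj v w -> 0 < j <= len v w ->
  near u (vtx v w j) -> (u = v /\ j <= rad v) \/ (u = w /\ (len v w).+1 - j <= rad w).
Proof.
move=> vw jl /existsP[w' /andP[uw' /mem_seg[k kl e]]].
have lu := long uw'.
rewrite /rad in kl *.
have [|[eu _ ek]|[eu _ ek]] := vtx_eq vw uw' jl _ e; [lia|left|right]; subst u.
  by split=> //; lia.
by split=> //; lia.
Qed.

Lemma near_vtx v w j : adj v w -> 0 < j <= rad v -> near v (vtx v w j).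
Proof.
move=> vw jl; apply/existsP; exists w; rewrite vw.
by apply/mem_seg; exists j; rewrite ?add1n.
Qed.

Lemma far_vtx v w j : adj v w -> 0 < j <= len v w ->
  far (vtx v w j) = (rad v < j) && (j + rad w <= len v w).
Proof.
move=> vw jl; rewrite /far (vtx_inner vw jl) /=; apply/idP/idP.
  move=> /existsPn nn; apply/andP; split; rewrite leqNgt; apply/negP => lt.
    by move/negP: (nn v); apply; apply: near_vtx => //; lia.
  move/negP: (nn w); apply; rewrite (vtx_rev vw); last by lia.
  by apply: near_vtx; rewrite 1?adj_sym //; lia.
move=> jj; apply/existsPn => u; apply/negP => /(nearP vw jl); rewrite /rad in jj *.
by move=> [[_]|[_]]; lia.
Qed.

Lemma near_inner x v : near v x -> x \notin Br.
Proof.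
move=> /existsP[w /andP[vw]]; apply: seg_inner => //.
by have := long vw; rewrite /rad; lia.
Qed.

(** A path leaving a branch vertex follows one edge: it either stops inside it
    or runs through all of it. *)
Lemma path_from_branch v q : is_path (branch D v :: q) -> q != [::] ->
  exists w, adj v w /\
   ((size q <= len v w /\ q = seg v w 1 (size q)) \/
    exists q2, q = seg v w 1 (len v w) ++ branch D w :: q2).
Proof.
move=> [uq pq] q0.
have start r : is_path (branch D v :: r) -> r != [::] -> (forall x, x \in r -> x \notin Br) ->
  exists w, [/\ adj v w, size r <= len v w & r = seg v w 1 (size r)].
  move=> [ur pr] r0 nb; have [|v' [w' [i [vw i0 il e]]]] := branch_free_path r0 _ nb.
    by split; [case/andP: ur | move: pr => /= /path_sorted].
  case: r r0 ur pr il {nb} e => // y r _ ur pr il e.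
  have ye : y = vtx v' w' i by case: e.
  have il' : 0 < i <= len v' w' by rewrite /= in il; lia.
  have yv : adj (vtx v' w' i) (branch D v) by rewrite -ye adj_sym; case/andP: pr.
  have [be|be] := nbr_vtx vw il' yv.
    have := branch_Br v; rewrite be => bB.
    case: i {i0} il' e il ye yv be bB => // -[|i] il' e il ye yv be bB.
      by move: vw il' il e; rewrite -(branch_inj be) => *; exists w'; split=> //.
    have jl : 0 < i.+1 <= len v' w' by lia.
    by have := vtx_inner vw jl; rewrite bB.
  have := branch_Br v; rewrite be => bB.
  have ie : i = len v' w'.
    apply/eqP; rewrite eqn_leq; case/andP: il' => _ -> /=; rewrite leqNgt; apply/negP => il2.
    have jl : 0 < i.+1 <= len v' w' by lia.
    by have := vtx_inner vw jl; rewrite bB.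
  subst i; rewrite vtx_last in be; have vw2 := branch_inj be; subst w'.
  have r1 : size (y :: r) = 1 by move: il; rewrite /=; lia.
  have wv : adj v v' by rewrite adj_sym.
  exists v'; rewrite (len_sym vw) r1; split; [by []|exact: len_gt0|].
  rewrite e r1 -[LHS]revK (rev_seg vw); last by lia.
  by rewrite /seg /=; congr [:: vtx _ _ _]; lia.
have [hB|hB] := boolP (has (mem Br) q); last first.
  have [w [vw sl e]] := start q (conj uq pq) q0 (fun x xq => hasPn hB x xq).
  by exists w; split=> //; left.
have [q1 [w [q2 [eq q1B]]]] := first_branch hB.
have q10 : q1 != [::].
  apply: contraTneq pq => q1e; rewrite eq q1e /=.
  apply/negP => /andP[/nbr_branch[w' [vw e]] _].
  have jl : 0 < 1 <= len v w' by rewrite len_gt0.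
  by have := vtx_inner vw jl; rewrite -e branch_Br.
move: uq; rewrite eq -cat_cons cat_uniq => /and3P[uq1 nq _].
move: pq; rewrite eq /= cat_path => /andP[pq1 /= /andP[lb _]].
have [|w' [vw sl e]] := start q1 (conj uq1 pq1) q10.
  exact: q1B.
exists w'; split=> //; right; exists q2.
have s0 : 0 < size q1 by case: (q1) q10.
have le : last (branch D v) q1 = vtx v w' (size q1).
  rewrite {1}e (last_nth (branch D v)) size_seg.
  by rewrite -[size q1 in LHS]prednK //= nth_seg ?prednK // add1n prednK.
rewrite le in lb; have [be|be] := nbr_vtx vw (introT andP (conj s0 sl)) lb.
  have s1 : (size q1).-1 = 0.
    apply/eqP; rewrite -leqn0 leqNgt; apply/negP => s2.
    have jl : 0 < (size q1).-1 <= len v w' by lia.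
    by have := vtx_inner vw jl; rewrite -be branch_Br.
  move: be nq; rewrite s1 vtx0 => /branch_inj ->.
  by rewrite /= inE eqxx.
have sq : size q1 = len v w'.
  apply/eqP; rewrite eqn_leq sl leqNgt; apply/negP => s2.
  have jl : 0 < (size q1).+1 <= len v w' by lia.
  by have := vtx_inner vw jl; rewrite -be branch_Br.
by move: be; rewrite sq vtx_last => /branch_inj ->; rewrite -sq -e.
Qed.

Lemma path_dec v q : is_path (branch D v :: q) -> q != [::] ->
  exists w, adj v w /\
   ((size q <= len v w /\ q = seg v w 1 (size q)) \/
    exists q2, q = seg v w 1 (len v w) ++ branch D w :: q2 /\ is_path (branch D w :: q2)).
Proof.
move=> qp q0; have [w [vw [|[q2 e]]]] := path_from_branch qp q0.
  by exists w; split=> //; left.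
exists w; split=> //; right; exists q2; split=> //.
have [uq pq] := qp; split.
  by move: uq; rewrite e -cat_cons cat_uniq => /and3P[].
by move: pq; rewrite e /= cat_path => /andP[_ /= /andP[]].
Qed.

(** Each branch vertex met is preceded by a whole edge, whose length exceeds the
    weight of that vertex by the factor [stretch]. *)
Lemma path_weight_le v q : is_path (branch D v :: q) -> 1000 * 100 * path_weight q <= size q.
Proof.
have [n] := ubnP (size q); elim: n v q => // n IH v q lt qp.
have [->|q0] := eqVneq q [::]; first by rewrite path_weight_nil.
have [w [vw [[sl ->]|[q2 [e q2p]]]]] := path_dec qp q0.
  rewrite path_weight_inner // => x; apply: seg_inner => //; lia.
move: lt; rewrite e path_weight_cat path_weight_cons weight_branch path_weight_inner; last first.
  by move=> x; apply: seg_inner.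
rewrite size_cat size_seg /= => lt.
have := IH _ _ _ q2p; have := long vw; lia.
Qed.

Lemma nfar_cat p q : nfar (p ++ q) = nfar p + nfar q.
Proof. exact: count_cat. Qed.

Lemma nfar_rev p : nfar (rev p) = nfar p.
Proof. exact: count_rev. Qed.

Lemma nfar_seg v w n : adj v w -> n <= len v w ->
  nfar (seg v w 1 n) <= minn n (rad v) + (n + rad w - len v w).
Proof.
move=> vw; elim: n => // n IH nl.
have -> : seg v w 1 n.+1 = seg v w 1 n ++ [:: vtx v w n.+1].
  by rewrite -(addn1 n) seg_cat add1n addn1.
rewrite nfar_cat /nfar /= far_vtx //.
have := IH (ltnW nl); rewrite /nfar => {}IH.
by case: (boolP ((rad v < n.+1) && _)) => /= h; lia.
Qed.

(** The vertices that are not far make up a small part of each edge traversed;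
    only the start near [v] must be accounted for separately. *)
Lemma nfar_path v q : is_path (branch D v :: q) ->
  200 * nfar q <= size q + 200 * rad v.
Proof.
have [n] := ubnP (size q); elim: n v q => // n IH v q lt qp.
have [->|q0] := eqVneq q [::]; first by [].
have [w [vw [[sl ->]|[q2 [e q2p]]]]] := path_dec qp q0.
  have := nfar_seg vw sl; rewrite size_seg; have := long vw; rewrite /rad; lia.
move: lt; rewrite e size_cat size_seg /= => lt.
have := IH _ _ _ q2p; have := nfar_seg vw (leqnn _); have := long vw; have := lam_gt0 w.
rewrite nfar_cat /nfar /= /rad; lia.
Qed.

Lemma path_near v q t x0 : is_path (branch D v :: q) -> 0 < t <= size q ->
  t <= rad v -> near v (nth x0 q t.-1).
Proof.
move=> qp tq tr; have q0 : q != [::] by apply: contraTneq tq => ->; case: t {tr}.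
have [w [vw [[sl ->]|[q2 [-> _]]]]] := path_dec qp q0.
  by rewrite nth_seg; [apply: near_vtx|]; lia.
have := long vw => lg.
rewrite nth_cat size_seg ifT; last by rewrite /rad in tr *; lia.
by rewrite nth_seg; [apply: near_vtx|]; rewrite /rad in tr *; lia.
Qed.

Lemma mem_split x p : x \in p -> exists a b : seq G, p = a ++ x :: b.
Proof. by case/splitPr => a b; exists a, b. Qed.

Lemma is_path_split p a x b : is_path p -> p = a ++ x :: b ->
  is_path (x :: b) /\ is_path (x :: rev a).
Proof.
move=> [up sp] e; move: up sp; rewrite e cat_uniq => /and3P[ua ha ub].
rewrite sorted_cat_cons => /andP[sa sb]; split=> //.
split; last first.
  rewrite -[x :: _]rev_rcons rev_sorted (eq_sorted (e' := @adj G)) //.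
  by move=> y z; rewrite adj_sym.
rewrite -rev_rcons rev_uniq rcons_uniq ua andbT.
by apply/negP => xa; case/hasP: ha; exists x; rewrite ?inE ?eqxx.
Qed.

Lemma is_path_rev p : is_path p -> is_path (rev p).
Proof.
move=> [up sp]; split; first by rewrite rev_uniq.
rewrite rev_sorted (eq_sorted (e' := @adj G)) // => y z.
by rewrite adj_sym.
Qed.

(** On a repetition of half-length [t], the partner of [v] is at distance [t] along
    the path, hence near [v] when [t <= rad v]. *)
Lemma partner_near p v t x0 : is_path p -> branch D v \in p -> size p = t.*2 ->
  t <= rad v -> exists2 i, i < t &
    (nth x0 p i = branch D v /\ near v (nth x0 p (t + i))) \/
    (nth x0 p (t + i) = branch D v /\ near v (nth x0 p i)).
Proof.
move=> pp /mem_split[a [b e]] + tr; subst p; rewrite size_cat /= => sp.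
have [pb pa] := is_path_split pp erefl.
have [lt|ge] := ltnP (size a) t.
  exists (size a) => //; left; rewrite nth_cat ltnn subnn; split=> //.
  rewrite nth_cat ltnNge leq_addl /= addnK.
  have t1 : 0 < t <= size b by lia.
  case: t t1 {sp lt} tr => // t t1 tr; exact: (path_near x0 pb t1 tr).
exists (size a - t); first by lia.
right; rewrite subnKC // nth_cat ltnn subnn; split=> //.
have t1 : 0 < t <= size (rev a) by rewrite size_rev; lia.
have := path_near x0 pa t1 tr; rewrite nth_cat ifT; last by lia.
rewrite nth_rev; last by lia.
by congr (near v (nth _ _ _)); lia.
Qed.

(** * Restricted lists and short repetitions through a branch vertex *)

Variables (C : Type) (f : G -> 'I_5 -> C).
Hypothesis f_inj : forall x, injective (f x).
Variable R : realFieldType.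

(** Near [v] the colour of [v] is forbidden.  The neighbourhoods of the branch
    vertices are disjoint, so at least four of the five colours remain. *)
Definition allowed x : {set 'I_5} :=
  [set a : 'I_5 | `[< forall v, near v x -> f x a <> f (branch D v) ord0 >] ].

Definition num S : R := #|good f allowed Br S|%:R%R.

(** The rate guaranteed for a vertex at distance [j] from [v] along an edge.  With
    one path per length, the repetitions cost sum_(t >= 1) 2^(1 - t) = 2 colours;
    this leaves 2 of the four colours available near [v], and almost 3 of the five
    available elsewhere. *)
Definition growth v j : R := (if (j <= rad v)%N then 2%:R else 29%:R / 10%:R)%R.

(** Colouring a tip, that is, a vertex whose neighbour away from [v] is uncoloured,
    multiplies the number of colourings by the rate.  The vertices close to the
    other end [w] are left to the opposite orientation of the edge. *)
Definition tip_growth S := forall v w j, adj v w -> 0 < j < len v w -> j + rad w <= len v w ->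
  vtx v w j \notin S -> vtx v w j.+1 \notin S ->
  (growth v j * num S <= num (vtx v w j |: S))%R.

(** A far vertex whose neighbours may both be coloured: much weaker, but enough to
    join the two coloured parts of an edge, or to start uncolouring in the middle
    of a coloured stretch. *)
Definition far_growth S := forall x, far x -> x \notin S ->
  (num S <= 2 ^+ 10 * num (x |: S))%R.

Definition growth_below n := forall S, [disjoint S & Br] -> #|S| < n ->
  tip_growth S /\ far_growth S.

Lemma card_allowed_far x : far x -> #|allowed x| = 5.
Proof.
move=> /andP[_ /existsPn fx]; rewrite -[RHS]card_ord -cardsT; apply: eq_card => a.
by rewrite !inE; apply/asboolP => v nv; have := fx v; rewrite nv.
Qed.

Lemma near_uniq v v' x : near v x -> near v' x -> v = v'.
Proof.
move=> nv nv'; have xB := near_inner nv.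
have [u [w [j [uw jl e]]]] := vertexE xB; subst x.
have lg := long uw.
case: (nearP uw jl nv) => -[-> h]; case: (nearP uw jl nv') => -[-> h'] //.
  by move: h h'; rewrite /rad; lia.
by move: h h'; rewrite /rad; lia.
Qed.

Lemma card_allowed x : 3 < #|allowed x|.
Proof.
have [/existsP[v nv]|/existsPn nn] := boolP [exists v, near v x]; last first.
  have -> : #|allowed x| = #|[set: 'I_5]|; last by rewrite cardsT card_ord.
  apply: eq_card => a; rewrite !inE; apply/asboolP => v nv.
  by have := nn v; rewrite nv.
pose B : {set 'I_5} := [set a | `[< f x a = f (branch D v) ord0 >] ].
have B1 : #|B| <= 1.
  apply/card_le1P => a; rewrite inE => /asboolP ea b; rewrite inE.
  by apply/asboolP/eqP => [eb|->//]; apply: (@f_inj x); rewrite eb ea.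
have sub : ~: B \subset allowed x.
  apply/subsetP => a; rewrite !inE => /asboolPn nb; apply/asboolP => v' nv'.
  by rewrite -(near_uniq nv nv').
apply: leq_trans (subset_leq_card sub).
by have := cardsC B; rewrite card_ord; lia.
Qed.

Local Notation bad := (bad f allowed Br).

Lemma half_transversal P t U : uniq P -> size P = t.*2 ->
  {subset U <= take t P} -> transversal P U.
Proof.
move=> uP sP UP s i x0 sP' si; have st : s = t by move: sP'; rewrite sP; lia.
subst s; apply/negP => /andP[_ /UP].
have szt : size (take t P) = t by rewrite size_takel // sP; lia.
rewrite -{1}(cat_take_drop t P) nth_cat szt.
rewrite ltnNge leq_addr /= addKn => h1.
have h2 : nth x0 (drop t P) i \in drop t P by rewrite mem_nth // size_drop sP; lia.
move: uP; rewrite -{1}(cat_take_drop t P) cat_uniq => /and3P[_ /hasPn/(_ _ h2)].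
by rewrite /= h1.
Qed.

Lemma size_count S x l : uniq l -> {subset l <= (x |: S) :|: Br} ->
  (forall y, y \in l -> y \notin Br) -> size l <= (count (mem S) l).+1.
Proof.
move=> ul ls nb; rewrite -(count_predC (mem S) l) -addn1 leq_add2l.
apply: (@leq_trans (count (pred1 x) l)); last by rewrite count_uniq_mem // leq_b1.
have -> : count (predC (mem S)) l = count (fun y => (y \notin S) && (y \in l)) l.
  by apply: eq_in_count => y /= ->; rewrite andbT.
apply: sub_count => y /andP[yS yl]; have := ls y yl.
by rewrite in_setU in_setU1 (negbTE yS) (negbTE (nb y yl)) !orbF.
Qed.

Lemma bad_rev S x P : bad S x P = bad S x (rev P).
Proof.
apply/setP => c; rewrite !inE; congr (_ && _); apply/asboolP/asboolP => h.
  exact: repetitive_rev.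
by rewrite -[P]revK; exact: repetitive_rev.
Qed.

(** A repetition through [v] is longer than [rad v]: otherwise the partner of [v]
    would be near [v], where the colour of [v] is forbidden. *)
Lemma bad_short S x P v t : [disjoint S & Br] -> x \notin Br -> is_path P ->
  {subset P <= (x |: S) :|: Br} ->
  size P = t.*2 -> branch D v \in P -> t <= rad v -> #|bad S x P| = 0.
Proof.
move=> SB xB pP PS sP vP tr; apply/eqP; rewrite cards_eq0; apply/set0Pn => -[c].
rewrite inE => /andP[cE /asboolP[s [s0 sP' h]]].
have st : s = t by move: sP'; rewrite sP; lia.
subst s; have [i it e] := partner_near (branch D v) pP vP sP tr.
move: cE; rewrite inE => /and3P[/goodP[_ cal _] cx /forallP c0].
have cv : c (branch D v) = ord0.
  apply/eqP/(implyP (c0 _)); rewrite in_setU1 negb_or.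
  have vB := branch_Br v; apply/andP; split; first by apply: contraNneq xB => <-.
  by apply/negP => vS; have := disjointFr SB vS; rewrite vB.
have key y : y \in P -> near v y -> f y (c y) <> f (branch D v) (c (branch D v)).
  move=> yP nv; have yB := near_inner nv.
  have cy : c y \in allowed y.
    have := PS y yP; rewrite in_setU in_setU1 (negbTE yB) orbF.
    case: eqP => [->//|_ /= yS].
    by have := cal y yS; rewrite ffunE yS.
  by move: cy; rewrite inE cv => /asboolP /(_ v nv).
have := h (branch D v) i it; have [m1 m2] := nth_twin_mem (branch D v) sP it.
case: e => -[e1 nv]; rewrite /paint e1 => h'.
  by apply: (key _ m2 nv).
by apply: (key _ m1 nv).
Qed.

(** On either side of [v], each branch vertex costs a whole edge; [v] itself is
    covered by [rad v < t]. *)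
Lemma path_weight_through v P t : is_path P -> size P = t.*2 -> branch D v \in P -> rad v < t ->
  1000 * 100 * path_weight P <= 502 * t.
Proof.
move=> pP sP /mem_split[a [b e]] rt; have [pb pa] := is_path_split pP e.
have h1 := path_weight_le pb; have h2 := path_weight_le pa.
rewrite path_weight_rev size_rev in h2; move: sP; rewrite e size_cat /= => sP.
rewrite path_weight_cat path_weight_cons weight_branch; move: rt h1 h2; rewrite /rad; lia.
Qed.

(** With branch vertices in both halves, the path contains a whole edge at [v],
    which dwarfs the near vertices around [v]. *)
Lemma nfar_through v P t : is_path P -> size P = t.*2 ->
  branch D v \in take t P -> has (mem Br) (drop t P) -> 1000 * 100 * lam v <= 2 * t /\
  200 * nfar P <= 2 * t + 400 * (200 * lam v) + 200.
Proof.
move=> pP sP /mem_split[a [b1 e1]] hB.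
have e : P = a ++ branch D v :: (b1 ++ drop t P) by rewrite -cat_cons catA -e1 cat_take_drop.
set b := b1 ++ _ in e; have hb : has (mem Br) b by rewrite has_cat hB orbT.
have [pb pa] := is_path_split pP e.
have h1 := nfar_path pb; have h2 := nfar_path pa.
rewrite nfar_rev size_rev in h2; move: sP; rewrite e size_cat /= => sP.
have b0 : b != [::] by apply: contraTneq hb => ->.
have [w [vw [[sl eb]|[q2 [eb _]]]]] := path_dec pb b0.
  case/hasP: hb => y yq yB; rewrite eb in yq.
  have /negP[] : y \notin Br by apply: (seg_inner vw _ _ yq); rewrite // add1n ltnS.
  exact: yB.
have lg := long vw; have sb : len v w < size b.
  by rewrite eb size_cat size_seg /= addnS ltnS leq_addr.
have nb : nfar (branch D v :: b) <= (nfar b).+1 by rewrite /nfar /= -add1n leq_add2r leq_b1.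
rewrite nfar_cat; move: h1 h2; rewrite /rad => h1 h2.
clearbody b; clear eb e1 e pb pa hB hb pP b0; split; lia.
Qed.

Lemma seg_transversal v w i a t : adj v w -> i + t.*2 <= (len v w).+2 ->
  a + t <= (len v w).+2 -> transversal (seg v w i t.*2) [set z in seg v w a t].
Proof.
move=> vw il al s k x0; rewrite size_seg => /double_inj <- ks.
rewrite !nth_seg; [|lia|lia].
rewrite !inE; apply/negP => /andP[/mem_seg[k1 h1 e1] /mem_seg[k2 h2 e2]].
have E1 := vtx_inj vw _ _ e1; have E2 := vtx_inj vw _ _ e2; lia.
Qed.

(** From an inner vertex of an edge, a path that meets a branch vertex has run
    along the edge up to one of its ends. *)
Lemma reach_branch P x : is_path P -> x \in P -> x \notin Br -> has (mem Br) P ->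
  exists u w s, [/\ adj u w, 0 < s <= len u w, x = vtx u w s, branch D u \in P &
    forall k, 0 < k <= s -> vtx u w k \in P].
Proof.
move=> pP xP xB hP; have [a [b e]] := mem_split xP.
have [pb pa] := is_path_split pP e.
have main l : is_path (x :: l) -> {subset l <= P} -> has (mem Br) l ->
  exists u w s, [/\ adj u w, 0 < s <= len u w, x = vtx u w s, branch D u \in P &
    forall k, 0 < k <= s -> vtx u w k \in P].
  move=> pl lP hl; have [q [u [r [el nq]]]] := first_branch hl.
  have pu : is_path (branch D u :: rev (x :: q)).
    have := is_path_split pl (a := x :: q) (x := branch D u) (b := r).
    by rewrite el => /(_ erefl)[].
  have [|w [uw [[sl eq]|[q2 [eq _]]]]] := path_dec pu.
  - by rewrite -size_eq0 size_rev.
  - exists u, w, (size (rev (x :: q))).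
    have qP : {subset rev (x :: q) <= P}.
      move=> y; rewrite mem_rev inE => /predU1P[->//|yq]; apply: lP.
      by rewrite el mem_cat yq.
    split=> //; first by rewrite sl size_rev.
    + have := nth_seg x u w 1 (n := size (rev (x :: q))) (k := (size (rev (x :: q))).-1).
      rewrite -eq size_rev /= => /(_ (ltnSn _)) <-.
      by rewrite nth_rev /= ?subnn.
    + by apply: lP; rewrite el mem_cat inE eqxx orbT.
    + by move=> k kl; apply: qP; rewrite eq; apply/mem_seg; exists k.
  have : branch D w \in rev (x :: q) by rewrite eq mem_cat inE eqxx orbT.
  rewrite mem_rev inE => /predU1P[wx|/nq]; last by rewrite branch_Br.
  by rewrite -wx branch_Br in xB.
have [hb|hb] := boolP (has (mem Br) b).
  by apply: (main b) => // y yb; rewrite e mem_cat inE yb !orbT.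
have ha : has (mem Br) (rev a).
  move: hP; rewrite e has_cat /= (negbTE hb) orbF => /orP[|xB']; first by rewrite has_rev.
  by case/negP: xB.
by apply: (main (rev a)) => // y; rewrite mem_rev e mem_cat => ->.
Qed.

(** * Weighted count of the paths through a vertex *)

(** The walks of [n] steps from [x] that start away from [y] and never turn back at
    once.  They include all paths, and unlike paths they are counted by a plain
    recursion. *)
Fixpoint walks n y x : seq (seq G) :=
  if n is n'.+1 then
    flatten [seq [seq z :: q | q <- walks n' x z] | z <- enum G & adj x z && (z != y)]
  else [:: [::]].

Lemma mem_walks q y x : path (@adj G) x q -> uniq (x :: q) -> y \notin q ->
  q \in walks (size q) y x.
Proof.
elim: q y x => //= z q IH y x /andP[xz pq] /andP[xq uq] yq.
apply/flatten_mapP; exists z.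
  rewrite mem_filter mem_enum xz /=; move: yq; rewrite inE negb_or eq_sym.
  by case/andP => ->.
apply/mapP; exists q => //; apply: IH => //.
by move: xq; rewrite inE negb_or => /andP[].
Qed.

Lemma size_walks q n y x : q \in walks n y x -> size q = n.
Proof.
elim: n q y x => [|n IH] q y x /=; first by rewrite inE => /eqP ->.
by move=> /flatten_mapP[z _ /mapP[q' /IH e ->]] /=; rewrite e.
Qed.

Lemma inner_nbrs x : x \notin Br -> exists y1 y2, forall z, adj x z -> z = y1 \/ z = y2.
Proof.
move=> /vertexE[v [w [j [vw jl ->]]]]; exists (vtx v w j.-1), (vtx v w j.+1) => z.
exact: nbr_vtx.
Qed.


(** At an inner vertex there is a single way to go on. *)
Lemma card_next_le x y : adj x y -> #|[set z | adj x z & z != y]| <= 4 ^ weight x.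
Proof.
move=> xy; have [/BrP[v e]|xB] := boolP (x \in Br).
  rewrite e weight_branch; apply: leq_trans (deg_lam v).
  apply: (@leq_trans #|[set vtx v w 1 | w in [set w | adj v w]]|); last exact: leq_imset_card.
  apply/subset_leq_card/subsetP => z; rewrite inE => /andP[+ _].
  by move=> /nbr_branch[w [vw ->]]; apply: imset_f; rewrite inE.
rewrite weight_inner // expn0; have [y1 [y2 h]] := inner_nbrs xB.
apply: (@leq_trans #|[set if y == y1 then y2 else y1]|); last by rewrite cards1.
apply/subset_leq_card/subsetP => z; rewrite !inE => /andP[xz zy].
case: (eqVneq y y1) => [e|ne]; case: (h z xz) => ez; rewrite ez ?eqxx //.
  by move: zy; rewrite ez e eqxx.
case: (h y xy) => ey; first by rewrite ey eqxx in ne.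
by move: zy; rewrite ez ey eqxx.
Qed.

Local Open Scope ring_scope.

Lemma sum_walksS n y x (F : seq G -> R) :
  \sum_(q <- walks n.+1 y x) F q =
  \sum_(z | adj x z && (z != y)) \sum_(q <- walks n x z) F (z :: q).
Proof.
rewrite /= big_flatten big_map big_filter big_enum_cond /=.
by apply: eq_bigr => z _; rewrite big_map.
Qed.

(** The branching at each vertex is compensated by its weight, so the weighted
    number of walks does not grow with their length. *)
Lemma sum_walks n y x : adj x y ->
  4 ^- weight x * \sum_(q <- walks n y x) 4 ^- path_weight q <= 1 :> R.
Proof.
elim: n y x => [|n IH] y x xy.
  rewrite /= big_seq1 path_weight_nil expr0 invr1 mulr1 invf_le1 ?exprn_gt0 //.
  by rewrite exprn_ege1 // ler1n.
rewrite sum_walksS mulrC ler_pdivrMr ?exprn_gt0 // mul1r.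
apply: (@le_trans _ _ (#|[set z | adj x z & z != y]|%:R)); last first.
  by rewrite -natrX ler_nat card_next_le.
rewrite cardsE -sum1_card natr_sum; apply: ler_sum => z /andP[xz _].
under eq_bigr do rewrite path_weight_cons exprD invfM.
by rewrite -mulr_sumr; apply: IH; rewrite adj_sym.
Qed.

Lemma sum_walks2 n x : x \notin Br -> \sum_(q <- walks n x x) 4 ^- path_weight q <= 2 :> R.
Proof.
move=> xB; case: n => [|n]; first by rewrite /= big_seq1 path_weight_nil expr0 invr1 ler1n.
rewrite sum_walksS; have [y1 [y2 h]] := inner_nbrs xB.
apply: (@le_trans _ _ (#|[set y1; y2]|%:R)); last by rewrite ler_nat cards2; case: eqP.
rewrite -sum1_card natr_sum [leRHS](bigID (adj x)) /=.
rewrite -[leLHS]addr0 lerD ?sumr_ge0 //.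
rewrite [leLHS](eq_bigl (fun z => (z \in [set y1; y2]) && adj x z)); last first.
  move=> z; have [xz|] := boolP (adj x z); last by rewrite andbF.
  have -> : z != x by apply: contraTneq xz => ->; rewrite adj_irrefl.
  by rewrite !inE; case: (h _ xz) => ->; rewrite eqxx ?orbT.
apply: ler_sum => z /andP[_ xz].
under eq_bigr do rewrite path_weight_cons exprD invfM.
by rewrite -mulr_sumr; apply: sum_walks; rewrite adj_sym.
Qed.

(** * Uncolouring runs of vertices *)

Lemma num_ge0 S : 0 <= num S. Proof. exact: ler0n. Qed.

Lemma growth_ge2 v j : 2 <= growth v j.
Proof. by rewrite /growth; case: ifP => _; lra. Qed.

Lemma disjoint_setD S T : [disjoint S & Br] -> [disjoint S :\: T & Br].
Proof. by move=> SB; apply: disjointWl SB; exact: subsetDl. Qed.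

Definition uncol S l := S :\: [set z in l].

Lemma uncol_nil S : uncol S [::] = S.
Proof. by apply/setP => z; rewrite !inE. Qed.

Lemma uncol_rcons S l z : uncol S (rcons l z) = uncol (S :\ z) l.
Proof. by apply/setP => y; rewrite !inE mem_rcons inE negb_or; case: eqP; case: (y \in l). Qed.

Lemma uncol_cons S l z : uncol S (z :: l) = uncol (S :\ z) l.
Proof. by apply/setP => y; rewrite !inE negb_or; case: eqP; case: (y \in l). Qed.

Lemma uncol_cat S l l' : uncol S (l ++ l') = uncol (uncol S l) l'.
Proof. by apply/setP => y; rewrite !inE mem_cat negb_or; case: (y \in l'); rewrite ?andbT ?andbF. Qed.

Lemma setD1_notin S z : z \notin S -> S :\ z = S.
Proof.
by move=> zS; apply/setP => y; rewrite !inE; case: eqP => // ->; rewrite (negbTE zS).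
Qed.

Lemma uncol_eq S l l' : l =i l' -> uncol S l = uncol S l'.
Proof. by move=> e; apply/setP => y; rewrite !inE e. Qed.

Lemma card_uncol S l : (#|uncol S l| <= #|S|)%N.
Proof. exact: subset_leq_card (subsetDl _ _). Qed.

Lemma card_setD1_lt S z : z \in S -> (#|S :\ z| < #|S|)%N.
Proof. by move=> zS; rewrite [X in (_ < X)%N](cardsD1 z) zS. Qed.

Lemma count_setD1 S z l : z \notin l -> count (mem (S :\ z)) l = count (mem S) l.
Proof.
move=> zl; apply: eq_in_count => y yl; rewrite !inE; case: eqP => // yz.
by rewrite -yz yl in zl.
Qed.

(** Once the outer end of an interval of an edge is uncoloured, the interval can
    be uncoloured vertex by vertex, each being a tip when its turn comes. *)
Lemma peel n S v w a m (r : R) : growth_below n -> [disjoint S & Br] -> (#|S| <= n)%N ->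
  adj v w -> (0 < a)%N -> (a + m <= len v w)%N -> (a + m + rad w <= (len v w).+1)%N ->
  vtx v w (a + m) \notin S -> 1 <= r -> (forall j, (a <= j)%N -> r <= growth v j) ->
  r ^+ count (mem S) (seg v w a m) * num (uncol S (seg v w a m)) <= num S.
Proof.
move=> gb + + vw a0 + + + r1 hr; elim: m S => [|m IH] S SB Sn al ar zS.
  by rewrite uncol_nil expr0 mul1r.
have es : seg v w a m.+1 = rcons (seg v w a m) (vtx v w (a + m)).
  by rewrite -(addn1 m) seg_cat cats1.
have us : vtx v w (a + m) \notin seg v w a m.
  by apply/negP => /mem_seg[k kl /(vtx_inj vw) e]; have := e ltac:(lia) ltac:(lia); lia.
rewrite es uncol_rcons -cats1 count_cat /= addn0.
have [uS|uS] := boolP (vtx v w (a + m) \in S); last first.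
  by rewrite /= addn0 setD1_notin //; apply: IH => //; lia.
have lt := card_setD1_lt uS.
have := IH (S :\ vtx v w (a + m)) (disjoint_setD _ SB) _ _ _ _.
rewrite count_setD1 // => IH'.
have {}IH' : r ^+ count (mem S) (seg v w a m) * num (uncol (S :\ vtx v w (a + m)) (seg v w a m))
    <= num (S :\ vtx v w (a + m)).
  by apply: IH'; rewrite ?inE ?eqxx //; lia.
have [tg _] := gb (S :\ vtx v w (a + m)) (disjoint_setD _ SB) ltac:(lia).
have := tg v w (a + m)%N vw ltac:(lia) ltac:(lia).
rewrite !inE eqxx /= -addnS negb_and zS orbT => /(_ isT isT).
rewrite setD1K // => {}tg; apply: le_trans tg.
rewrite addn1 exprS -mulrA; apply: ler_pM => //.
- by apply: le_trans r1.
- by rewrite mulr_ge0 ?num_ge0 // exprn_ge0 // (le_trans _ r1).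
- by apply: hr; lia.
Qed.

Lemma far_num S x n : growth_below n -> [disjoint S & Br] -> (#|S| <= n)%N ->
  far x -> num (S :\ x) <= 2 ^+ 10 * num S.
Proof.
move=> gb SB Sn fx; have [xS|xS] := boolP (x \in S).
  have lt := card_setD1_lt xS.
  have [_ /(_ x fx)] := gb (S :\ x) (disjoint_setD _ SB) ltac:(lia).
  by rewrite !inE eqxx setD1K //; apply.
rewrite setD1_notin // -[leLHS]mul1r ler_wpM2r ?num_ge0 //.
by rewrite exprn_ege1 // ler1n.
Qed.

(** If an interval of an edge contains a far vertex, uncolour that vertex first, at
    the price of [far_growth]; then both sides can be peeled off. *)
Lemma remove_run n S v w a m (z : nat) : growth_below n -> [disjoint S & Br] -> (#|S| <= n)%N ->
  adj v w -> (0 < a)%N -> (a + m <= (len v w).+1)%N ->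
  (a <= z < a + m)%N -> (rad v < z)%N -> (z + rad w <= len v w)%N ->
  2 ^+ count (mem S) (seg v w a m) * num (uncol S (seg v w a m)) <= 2 ^+ 11 * num S.
Proof.
move=> gb SB Sn vw a0 al zl zv zw.
(* the part beyond [z], read from the other end of the edge, starts at [b] *)
pose b := ((len v w).+2 - (a + m))%N; pose m2 := (a + m - z.+1)%N.
have lw := len_sym vw; have wv : adj w v by rewrite adj_sym.
have [e1 e2 em] : [/\ a + (z - a) = z, (len v w).+1 - (b + m2) = z & m = (z - a) + (1 + m2)]%N.
  by rewrite /b /m2; split; lia.
have [i1 i2 i3 i4 i5] : [/\ z <= len v w, z + rad w <= (len v w).+1, (0 < b),
   b + m2 <= len w v & b + m2 + rad v <= (len w v).+1]%N.
  by rewrite lw /b /m2; split; lia.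
have [j1 j2 j3 j4] : [/\ 0 < z <= len v w, z.+1 + m2 <= (len v w).+2,
   b + m2 <= (len v w).+1 & (len v w).+2 - (z.+1 + m2) = b]%N.
  by rewrite /b /m2; split; lia.
have inj (i j : nat) : (i <= (len v w).+1)%N -> (j <= (len v w).+1)%N ->
  vtx v w i = vtx v w j -> i = j by exact: vtx_inj.
have zl1 : vtx v w z \notin seg v w a (z - a).
  by apply/negP => /mem_seg[k kl e]; have := inj _ _ _ _ e; lia.
have zl2 : vtx v w z \notin seg v w z.+1 m2.
  by apply/negP => /mem_seg[k kl e]; have := inj _ _ _ _ e; lia.
have dl : ~~ has (mem (seg v w a (z - a))) (seg v w z.+1 m2).
  apply/hasPn => y /mem_seg[k kl ->]; apply/negP => /mem_seg[k' kl' e].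
  by have := inj _ _ _ _ e; lia.
have es : seg v w a m = rcons (seg v w a (z - a)) (vtx v w z) ++ seg v w z.+1 m2.
  by rewrite -cats1 -catA [in LHS]em !seg_cat e1 addn1.
have fz : far (vtx v w z) by rewrite far_vtx // zv zw.
have el2 : rev (seg v w z.+1 m2) = seg w v b m2 by rewrite (rev_seg vw j2) j4.
have r1 : 1 <= 2 :> R by rewrite ler1n.
have g2 u (i j : nat) : (i <= j)%N -> 2 <= growth u j by move=> _; exact: growth_ge2.
move: (seg v w z.+1 m2) zl2 dl es el2 => l2 zl2 dl es el2.
have le1 := far_num gb SB Sn fz.
set S1 := S :\ vtx v w z in le1; have S1B : [disjoint S1 & Br] := disjoint_setD _ SB.
have S1n : (#|S1| <= n)%N by apply: leq_trans Sn; exact: subset_leq_card (subsetDl _ _).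
have zS1 : vtx v w z \notin S1 by rewrite !inE eqxx.
set l1 := seg v w a (z - a) in zl1 dl es.
set S2 := uncol S1 l1; have S2B : [disjoint S2 & Br] := disjoint_setD _ S1B.
have S2n : (#|S2| <= n)%N by apply: leq_trans S1n; exact: card_uncol.
have le2 : 2 ^+ count (mem S1) l1 * num S2 <= num S1.
  by apply: (peel gb S1B S1n vw a0 _ _ _ r1 (g2 v a)); rewrite e1.
have le3 : 2 ^+ count (mem S2) l2 * num (uncol S2 l2) <= num S2.
  rewrite -(count_rev _ l2) (uncol_eq _ (fun y => esym (mem_rev l2 y))) el2.
  apply: (peel gb S2B S2n wv i3 i4 i5 _ r1 (g2 w b)).
  by rewrite (vtx_sym vw j3) e2 !inE eqxx !andbF.
have e3 : uncol S (seg v w a m) = uncol S2 l2 by rewrite es uncol_cat uncol_rcons.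
have c1 : count (mem S1) l1 = count (mem S) l1 by exact: count_setD1.
have c2 : count (mem S2) l2 = count (mem S) l2.
  apply: eq_in_count => y yl2; rewrite !inE.
  have -> : y \notin l1 by apply: contra dl => yl1; apply/hasP; exists y.
  by case: eqP => // yz; rewrite -yz yl2 in zl2.
have c : (count (mem S) (seg v w a m) <= (count (mem S) l1 + count (mem S) l2).+1)%N.
  rewrite es count_cat -cats1 count_cat /= addn0 addnAC -addn1 leq_add2l.
  exact: leq_b1.
rewrite e3; apply: (@le_trans _ _ (2 * (2 ^+ count (mem S) l1 * (2 ^+ count (mem S) l2 * num (uncol S2 l2))))).
  rewrite !mulrA -exprS -exprD ler_wpM2r ?num_ge0 //.
  by apply: ler_weXn2l.
rewrite exprS -mulrA ler_pM2l //; apply: le_trans le1; apply: le_trans le2.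
by rewrite -c1 -c2; apply: ler_wpM2l le3; rewrite exprn_ge0.
Qed.

Lemma far_tip S x y n : growth_below n -> [disjoint S & Br] -> (#|S| <= n)%N ->
  far x -> far y -> adj x y -> y \in S -> x \notin S -> 2 * num (S :\ y) <= num S.
Proof.
move=> gb SB Sn fx fy xy yS xS; have lt := card_setD1_lt yS.
have [tg _] := gb (S :\ y) (disjoint_setD _ SB) ltac:(lia).
have {}tg v w j : adj v w -> (0 < j <= len v w)%N -> y = vtx v w j -> x = vtx v w j.+1 ->
    2 * num (S :\ y) <= num S.
  move=> vw jl ye xe; move: fy; rewrite ye far_vtx // => /andP[jv jw].
  have jl1 : (j < len v w)%N.
    have xB : x \notin Br by case/andP: fx.
    have : (0 < j.+1 <= len v w)%N by apply: (vtx_innerP vw); rewrite -?xe //; lia.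
    by case/andP.
  have jl' : (0 < j < len v w)%N by case/andP: jl => -> _.
  have yS' : y \notin S :\ y by rewrite !inE eqxx.
  have xS' : x \notin S :\ y by rewrite inE (negbTE xS) andbF.
  have := tg v w j vw jl' jw; rewrite -ye -xe => /(_ yS' xS'); rewrite setD1K //.
  apply: le_trans.
  by rewrite ler_wpM2r ?num_ge0 // growth_ge2.
have yB : y \notin Br by case/andP: fy.
have [v [w [j [vw jl ye]]]] := vertexE yB.
have [xe|xe] := nbr_vtx vw jl (y := x) ltac:(by rewrite -ye adj_sym); last exact: (tg v w j).
have wv : adj w v by rewrite adj_sym.
apply: (tg w v ((len v w).+1 - j)%N wv); rewrite ?(len_sym vw); first by clear - jl; lia.
  by rewrite ye (vtx_rev vw) //; clear - jl; lia.
by rewrite xe (vtx_rev vw); [congr vtx|]; clear - jl; lia.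
Qed.

Definition far_seq l := [seq y <- l | far y].

(** Uncolour the far vertices of a path in order: each is a tip when its turn comes,
    except for the first of each stretch of far vertices.  A stretch begins at the
    start of the path or after a vertex that is not far, whence the exponent. *)
Lemma remove_far n l S : growth_below n -> [disjoint S & Br] -> (#|S| <= n)%N ->
  is_path l ->
  2 ^+ count (mem S) (far_seq l) * num (uncol S (far_seq l)) <= 2 ^+ (11 * (nfar l).+1) * num S.
Proof.
move=> gb + + [ul sl].
have base (a : nat) T : num T <= 2 ^+ a * num T.
  by rewrite -[leLHS]mul1r ler_wpM2r ?num_ge0 // exprn_ege1 // ler1n.
suff [] : (forall S, [disjoint S & Br] -> (#|S| <= n)%N ->
   2 ^+ count (mem S) (far_seq l) * num (uncol S (far_seq l)) <= 2 ^+ (11 * (nfar l).+1) * num S) /\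
  (forall x S, far x -> x \notin S -> [disjoint S & Br] -> (#|S| <= n)%N -> path (@adj G) x l ->
   2 ^+ count (mem S) (far_seq l) * num (uncol S (far_seq l)) <= 2 ^+ (11 * nfar l) * num S) by auto.
elim: l ul sl => [|y l IH] /= ul sl.
  have e0 T : 2 ^+ 0 * num (uncol T [::]) = num T by rewrite uncol_nil expr0 mul1r.
  by split=> [T _ _|x T _ _ _ _ _]; rewrite e0; exact: base.
case/andP: ul => yl ul; have {IH}[IHB IHA] := IH ul (path_sorted sl).
have yl' : y \notin far_seq l by rewrite mem_filter negb_and yl orbT.
have [fy|fy] := boolP (far y); rewrite /= ?fy /=; last first.
  rewrite add1n; split=> [T TB Tn|x T _ _ TB Tn _].
    apply: le_trans (IHB T TB Tn) _; rewrite ler_wpM2r ?num_ge0 //.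
    by apply: ler_weXn2l; [rewrite ler1n|rewrite /nfar; lia].
  by apply: le_trans (IHB T TB Tn) _; rewrite ler_wpM2r ?num_ge0.
have main T (c : R) (cn : nat) : [disjoint T & Br] -> (#|T| <= n)%N -> c = 2 ^+ cn ->
    (y \in T -> 2 * num (T :\ y) <= c * num T) ->
    2 ^+ ((y \in T) + count (mem T) (far_seq l)) * num (uncol T (y :: far_seq l)) <=
      2 ^+ (11 * nfar l) * (c * num T).
  move=> TB Tn ce h; rewrite uncol_cons.
  have h1 := IHA y (T :\ y) fy _ (disjoint_setD _ TB) _ sl.
  have {}h1 : 2 ^+ count (mem T) (far_seq l) * num (uncol (T :\ y) (far_seq l)) <=
      2 ^+ (11 * nfar l) * num (T :\ y).
    rewrite -(count_setD1 T yl'); apply: h1; first by rewrite !inE eqxx.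
    by apply: leq_trans Tn; exact: subset_leq_card (subsetDl _ _).
  have [yT|yT] := boolP (y \in T).
    rewrite add1n exprS -mulrA; apply: (@le_trans _ _ (2 * (2 ^+ (11 * nfar l) * num (T :\ y)))).
      by rewrite ler_pM2l.
    by rewrite mulrCA ler_pM2l ?exprn_gt0 // h.
  rewrite add0n; apply: (le_trans h1); rewrite setD1_notin // ler_pM2l ?exprn_gt0 //.
  by rewrite ce; exact: base.
rewrite /nfar /= ?fy /= ?add0n -/(nfar l); split=> [T TB Tn|x T fx xT TB Tn /andP[xy _]].
  rewrite mulnS (addnC 11%N) (exprD _ _ 11) -(mulrA (2 ^+ (11 * nfar l))); apply: (main T _ 11%N TB Tn erefl) => yT.
  by rewrite exprS -mulrA ler_pM2l //; exact: far_num gb TB Tn fy.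
have := main T 1 0%N TB Tn erefl _; rewrite mul1r; apply => yT.
exact: (far_tip gb TB Tn fx fy xy yT xT).
Qed.

(** * Repetitions through branch vertices *)

Lemma bad_num S x P U : [disjoint S & Br] ->
  {subset U <= P} -> {subset P <= (x |: S) :|: Br} -> transversal P U ->
  #|bad S x P|%:R <= 5 * num (S :\: U).
Proof. by move=> SB UP PS tU; rewrite /num -natrM ler_nat; exact: card_bad5. Qed.

(** A half [q] without branch vertices lies in one edge.  It is longer than [rad v]
    and so contains a far vertex, which makes [remove_run] applicable. *)
Lemma minor_run n S x q v r t : growth_below n -> [disjoint S & Br] -> (#|S| <= n)%N ->
  is_path (q ++ branch D v :: r) -> {subset q ++ branch D v :: r <= (x |: S) :|: Br} ->
  size (q ++ branch D v :: r) = t.*2 ->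
  (forall y, y \in q -> y \notin Br) -> (t <= size q)%N -> (rad v < t)%N ->
  2 ^+ t * #|bad S x (q ++ branch D v :: r)|%:R <= 2 ^+ 15 * num S.
Proof.
move=> gb SB Sn pP PS sP nb tq rt.
set P := q ++ _ in pP PS sP *; have [_ pq] := is_path_split pP erefl.
have q0 : rev q != [::].
  by rewrite -size_eq0 size_rev; case: (q) tq => //=; move: rt; case: (t).
have [w [vw [[sl e]|[q2 [e _]]]]] := path_dec pq q0; last first.
  have : branch D w \in q by rewrite -mem_rev e mem_cat inE eqxx orbT.
  by move=> /nb; rewrite branch_Br.
move: sl e; rewrite size_rev => sl e.
(* reversed, [q] fills the positions 1 to [size q] of the edge from [v]; the half
   of the path without branch vertices fills the last [t] of them *)
pose a := (size q - t).+1.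
have sq : (size q < t.*2)%N by rewrite -sP /P size_cat /= addnS ltnS leq_addr.
have lg := long vw.
(* the outermost far position reached by [q] *)
pose z := minn (size q) (len v w - rad w).
have [a1 a2 a3 [a4 a5]] : [/\ (0 < a)%N, (a + t <= (len v w).+1)%N, (a <= z < a + t)%N &
    (rad v < z)%N /\ (z + rad w <= len v w)%N].
  rewrite /z /a; clear - sl tq rt sq lg; move: lg sl tq rt sq; rewrite /rad => *.
  by split; [| | |split]; lia.
have et : take t P =i seg v w a t.
  have -> : seg v w a t = drop (size q - t) (rev q).
    have -> : rev q = seg v w 1 (size q - t) ++ seg v w (1 + (size q - t)) t.
      by rewrite -seg_cat subnK.
    by rewrite drop_size_cat ?size_seg.
  by move=> y; rewrite /P takel_cat // drop_rev subKn // mem_rev.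
have sub : {subset seg v w a t <= P} by move=> y; rewrite -et => /mem_take.
have cnt : (t <= (count (mem S) (seg v w a t)).+1)%N.
  rewrite -{1}(size_seg v w a t); apply: (@size_count _ x).
  - by apply: uniq_seg => //; apply: leq_trans a2 _.
  - by move=> y /sub /PS.
  - by move=> y; apply: seg_inner.
have tr : transversal P [set y in seg v w a t].
  by case: (pP) => uP _; apply: (half_transversal uP sP) => y; rewrite inE et.
have hb := bad_num SB (fun y yU => sub y (eq_ind _ is_true yU _ (in_set _ y))) PS tr.
have hr := remove_run gb SB Sn vw a1 a2 a3 a4 a5.
apply: (@le_trans _ _ (2 ^+ t * (5 * num (uncol S (seg v w a t))))).
  by rewrite ler_pM2l ?exprn_gt0.
apply: (@le_trans _ _ (2 ^+ (count (mem S) (seg v w a t)).+1 * (8 * num (uncol S (seg v w a t))))).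
  apply: ler_pM; rewrite ?exprn_ge0 ?mulr_ge0 ?num_ge0 //.
    by apply: ler_weXn2l; rewrite ?ler1n.
  by rewrite ler_wpM2r ?num_ge0 // ler_nat.
have -> : 2 ^+ 15 = 16 * 2 ^+ 11 :> R.
  have -> : 16 = 2 ^+ 4 :> R by rewrite -natrX.
  by rewrite -exprD.
move: hr; set c := count _ _; set N' := num _ => hr.
have -> : 2 ^+ c.+1 * (8 * N') = 16 * (2 ^+ c * N') by rewrite exprS; ring.
by rewrite -mulrA ler_pM2l.
Qed.

(** Here only far vertices of a half are uncoloured; this loses a factor for each
    vertex that is not far. *)
Lemma minor_walk n S x P t : growth_below n -> [disjoint S & Br] -> (#|S| <= n)%N ->
  is_path P -> {subset P <= (x |: S) :|: Br} -> size P = t.*2 ->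
  2 ^+ t * #|bad S x P|%:R <= 2 ^+ (15 + 12 * nfar P) * num S.
Proof.
move=> gb SB Sn pP PS sP; have [uP soP] := pP.
set h := take t P; have hP : {subset h <= P} by move=> y; exact: mem_take.
have ph : is_path h.
  split; first exact: take_uniq.
  by move: soP; rewrite -{1}(cat_take_drop t P) => /cat_sorted2[].
have sh : size h = t by rewrite size_take sP; case: ltnP; lia.
have nh : (nfar h <= nfar P)%N by rewrite -[X in (_ <= nfar X)%N](cat_take_drop t P) nfar_cat leq_addr.
have fh : {subset far_seq h <= h} by move=> y; rewrite mem_filter => /andP[].
have cnt : (t <= nfar h + (count (mem S) (far_seq h)).+1)%N.
  apply: (@leq_trans (nfar h + size (far_seq h))).
    by rewrite size_filter -{1}sh -(count_predC far h) addnC.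
  rewrite leq_add2l; apply: (@size_count _ x); first by rewrite filter_uniq // take_uniq.
    by move=> y /fh /hP /PS.
  by move=> y; rewrite mem_filter => /andP[/andP[]].
have tr : transversal P [set y in far_seq h].
  by apply: (half_transversal uP sP) => y; rewrite inE => /fh.
have sub : {subset [set y in far_seq h] <= P}.
  by move=> y; rewrite inE => /fh /hP.
have hb := bad_num SB sub PS tr.
have hr := remove_far gb SB Sn ph.
have rn : 0 <= num (uncol S (far_seq h)) by exact: num_ge0.
set c := count (mem S) _ in cnt hr; set N' := num (uncol _ _) in rn hr.
apply: (@le_trans _ _ (2 ^+ (nfar h + c.+1) * (8 * N'))).
  apply: ler_pM; rewrite ?exprn_ge0 //.
    by apply: ler_weXn2l; rewrite ?ler1n.
  by apply: (le_trans hb); rewrite ler_wpM2r // ler_nat.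
have -> : 2 ^+ (nfar h + c.+1) * (8 * N') = 2 ^+ (nfar h + 4) * (2 ^+ c * N').
  have e4 : 2 ^+ 4 = 16 :> R by rewrite -natrX.
  by rewrite addnS exprS !exprD e4; ring.
apply: (@le_trans _ _ (2 ^+ (nfar h + 4) * (2 ^+ (11 * (nfar h).+1) * num S))).
  by rewrite ler_pM2l ?exprn_gt0.
rewrite mulrA -exprD ler_wpM2r ?num_ge0 //.
by apply: ler_weXn2l; [rewrite ler1n|lia].
Qed.

(** Either one half avoids the branch vertices, and [minor_run] applies to the path
    or to its reverse, or both halves meet them; then the path is so long that
    few of its vertices are not far, and [minor_walk] loses little. *)
Lemma minor_pow n S x P t : growth_below n -> [disjoint S & Br] -> (#|S| <= n)%N ->
  is_path P -> {subset P <= (x |: S) :|: Br} -> size P = t.*2 -> has (mem Br) P ->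
  (forall v, branch D v \in P -> (rad v < t)%N) ->
  exists k, [/\ (200 < t)%N, (4 * (k + 2 * path_weight P) <= t)%N &
    2 ^+ t * #|bad S x P|%:R <= 2 ^+ (15 + k) * num S].
Proof.
move=> gb SB Sn.
have run Q : is_path Q -> {subset Q <= (x |: S) :|: Br} -> size Q = t.*2 -> has (mem Br) Q ->
    (forall v, branch D v \in Q -> (rad v < t)%N) -> ~~ has (mem Br) (take t Q) ->
    2 ^+ t * #|bad S x Q|%:R <= 2 ^+ 15 * num S.
  move=> pQ QS sQ hQ lQ nQ; have [q [v [r [e nq]]]] := first_branch hQ.
  have tq : (t <= size q)%N.
    rewrite leqNgt; apply: contra nQ => qt; apply/hasP; exists (branch D v).
      by rewrite e take_cat ltnNge (ltnW qt) /= mem_cat -(subnSK qt) /= inE eqxx orbT.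
    exact: branch_Br.
  rewrite e; apply: (minor_run gb SB Sn); rewrite -?e //.
  by apply: lQ; rewrite e mem_cat inE eqxx orbT.
move=> pP PS sP hP lP.
have [v vP] : exists v, branch D v \in P.
  by case/hasP: hP => y yP /BrP[v yv]; exists v; rewrite -yv.
have rt := lP v vP; have lv := lam_gt0 v.
have LP := path_weight_through pP sP vP rt.
have t200 : (200 < t)%N by move: rt; rewrite /rad; lia.
have [h1|h1] := boolP (has (mem Br) (take t P)); last first.
  by exists 0%N; split=> //; [lia|exact: run].
have [h2|h2] := boolP (has (mem Br) (drop t P)); last first.
  exists 0%N; split=> //; first by lia.
  rewrite bad_rev; apply: run; rewrite ?size_rev //.
  - exact: is_path_rev.
  - by move=> y; rewrite mem_rev; exact: PS.
  - by rewrite has_rev.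
  - by move=> u; rewrite mem_rev; exact: lP.
  - by rewrite take_rev has_rev sP -addnn addnK.
case/hasP: h1 => y yt /BrP[u yu]; rewrite yu in yt.
have [l1 l2] := nfar_through pP sP yt h2; have lu := lam_gt0 u.
exists (12 * nfar P)%N; split=> //; first by lia.
exact: (minor_walk gb SB Sn pP PS sP).
Qed.

(** The form in which the costs are summed: the factor [4 ^- path_weight P] cancels
    the number of paths, and [24 * t] leaves a third of a geometric term after the
    [8 * t] of [sum_throughs]. *)
Lemma minor_bad n S x P t : growth_below n -> [disjoint S & Br] -> (#|S| <= n)%N ->
  is_path P -> {subset P <= (x |: S) :|: Br} -> size P = t.*2 -> has (mem Br) P ->
  (forall v, branch D v \in P -> (rad v < t)%N) ->
  #|bad S x P|%:R <= (2 / 3) ^+ t / (24 * t%:R) * num S * 4 ^- path_weight P.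
Proof.
move=> gb SB Sn pP PS sP hP lP.
have [k [t200 kt le]] := minor_pow gb SB Sn pP PS sP hP lP.
have t0 : 0 < 24 * t%:R :> R by rewrite mulr_gt0 // ltr0n; lia.
have p2 a : 0 < 2 ^+ a :> R by rewrite exprn_gt0.
have e4 : 4 ^+ path_weight P = 2 ^+ (2 * path_weight P) :> R.
  by rewrite exprM; congr (_ ^+ _); rewrite -natrX.
have pb := pow_bound R t200 kt; rewrite addnA exprD in pb.
rewrite e4 ler_pdivlMr // mulrAC ler_pdivlMr // -(ler_pM2l (p2 t)).
have -> : 2 ^+ t * ((2 / 3) ^+ t * num S) = (4 / 3) ^+ t * num S :> R.
  by rewrite mulrA -exprMn; congr (_ ^+ _ * _); field.
have -> : 2 ^+ t * (#|bad S x P|%:R * 2 ^+ (2 * path_weight P) * (24 * t%:R)) =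
  (24 * t%:R * 2 ^+ (2 * path_weight P)) * (2 ^+ t * #|bad S x P|%:R) :> R by ring.
apply: (@le_trans _ _ ((24 * t%:R * 2 ^+ (2 * path_weight P)) * (2 ^+ (15 + k) * num S))).
  by rewrite ler_wpM2l // mulr_ge0 // ltW.
rewrite mulrA ler_wpM2r ?num_ge0 //; apply: le_trans pb.
by rewrite mulrAC mulrA.
Qed.

(** A superset of the paths of [2 * t] vertices through [x], in both directions: two
    walks from [x] joined. *)
Definition throughs x t : seq (seq G) := flatten
  [seq [seq rev a ++ x :: b | a <- walks i x x, b <- walks (t.*2.-1 - i) x x] | i <- iota 0 t.*2].

Lemma throughsP P x t : (0 < t)%N -> P \in throughs x t -> size P = t.*2 /\ x \in P.
Proof.
move=> t0 /flatten_mapP[i]; rewrite mem_iota => it /allpairsP[[a b] /= [/size_walks sa /size_walks sb ->]].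
by rewrite size_cat size_rev /= sa sb mem_cat inE eqxx orbT; split=> //; lia.
Qed.

Lemma mem_throughs P x t : is_path P -> x \in P -> size P = t.*2 -> P \in throughs x t.
Proof.
move=> pP /mem_split[a [b e]] sP; have [[ub pb] [ua pa]] := is_path_split pP e.
have s : (size a + (size b).+1 = t.*2)%N by rewrite -sP e size_cat.
apply/flatten_mapP; exists (size a); first by rewrite mem_iota; lia.
apply/allpairsP; exists (rev a, b); split; rewrite /= ?revK //.
  by rewrite -size_rev mem_walks //; case/andP: ua.
have -> : (t.*2.-1 - size a)%N = size b by lia.
by rewrite mem_walks //; case/andP: ub.
Qed.

Lemma sum_throughs x t : x \notin Br -> \sum_(P <- throughs x t) 4 ^- path_weight P <= 8 * t%:R :> R.
Proof.
move=> xB; rewrite big_flatten big_map.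
apply: (@le_trans _ _ (\sum_(i <- iota 0 t.*2) 4)); last first.
  rewrite big_const_seq count_predT size_iota iter_addr_0.
  by rewrite -[leLHS]mulr_natr -mul2n natrM mulrA -natrM.
apply: ler_sum => i _; rewrite big_allpairs_dep.
under eq_bigr => a _ do under eq_bigr => b _ do
  rewrite path_weight_cat path_weight_cons path_weight_rev (weight_inner xB) add0n exprD invfM.
under eq_bigr do rewrite -mulr_sumr.
rewrite -mulr_suml [leRHS](_ : 4 = 2 * 2 :> R); last by rewrite -natrM.
have h0 s : 0 <= \sum_(q <- s) 4 ^- path_weight q :> R.
  by apply: sumr_ge0 => q _; rewrite invr_ge0 exprn_ge0.
have h2 k : \sum_(q <- walks k x x) 4 ^- path_weight q <= 2 :> R by exact: sum_walks2.
exact: (ler_pM (h0 _) (h0 _) (h2 _) (h2 _)).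
Qed.

(** Called minor because their total cost is negligible, see [sum_minors]. *)
Definition minor S x P := [&& uniq P, sorted (@adj G) P, all (mem ((x |: S) :|: Br)) P & has (mem Br) P].

Definition minors S x := [seq P <- flatten [seq throughs x t | t <- iota 1 #|G|] | minor S x P].

Lemma mem_minors S x P t : is_path P -> x \in P -> size P = t.*2 -> (0 < t)%N ->
  {subset P <= (x |: S) :|: Br} -> has (mem Br) P -> P \in minors S x.
Proof.
move=> pP xP sP t0 PS hP; case: (pP) => uP soP.
rewrite mem_filter /minor uP soP hP /= andbT; apply/andP; split; first exact/allP.
apply/flatten_mapP; exists t; last exact: mem_throughs.
have := max_card (mem P); rewrite (card_uniqP uP) sP mem_iota t0 add1n ltnS.
by apply: leq_trans; rewrite -addnn leq_addr.
Qed.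

(** Telescoping: a third of [(2 / 3) ^+ t] is the difference of two consecutive powers. *)
Lemma sum_geo (A0 T : nat) : \sum_(t <- iota 1 T) (A0 < t)%:R * ((2 / 3) ^+ t / 3) +
  (2 / 3) ^+ (maxn T A0).+1 <= (2 / 3) ^+ A0.+1 :> R.
Proof.
elim: T => [|T IH]; first by rewrite big_nil add0r max0n.
rewrite -(addn1 T) iotaD big_cat /= big_seq1 add1n addn1.
apply: le_trans IH; rewrite -addrA lerD2l.
case: ltnP => h; last first.
  by rewrite mul0r add0r (maxn_idPr (ltnW h)).
rewrite mul1r (maxn_idPl (ltnSE h)).
rewrite [(2 / 3) ^+ T.+2]exprS -subr_ge0; lra.
Qed.

(** All repetitions of [x |: S] through a branch vertex, summed over their
    half-length [t > A0]: there are [2 * t] positions for [x], each contributing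
    weight at most 4, and [minor_bad] bounds the cost of one path. *)
Lemma sum_minors n S x (A0 : nat) : growth_below n -> [disjoint S & Br] -> (#|S| <= n)%N ->
  x \notin Br ->
  (forall P, is_path P -> {subset P <= (x |: S) :|: Br} -> x \in P -> has (mem Br) P ->
     exists2 v, branch D v \in P & (A0 <= rad v)%N) ->
  (\sum_(P <- minors S x) #|bad S x P|)%:R <= (2 / 3) ^+ A0.+1 * num S.
Proof.
move=> gb SB Sn xB hA; rewrite natr_sum big_filter big_flatten big_map.
apply: (@le_trans _ _ ((\sum_(t <- iota 1 #|G|) (A0 < t)%:R * ((2 / 3) ^+ t / 3)) * num S)); last first.
  rewrite ler_wpM2r ?num_ge0 //; apply: le_trans (sum_geo A0 #|G|).
  by rewrite lerDl exprn_ge0 // divr_ge0.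
rewrite mulr_suml big_seq [leRHS]big_seq; apply: ler_sum => t; rewrite mem_iota => /andP[t0 _].
have tr : 0 < t%:R :> R by rewrite ltr0n.
have q0 : 0 <= (2 / 3) ^+ t :> R by rewrite exprn_ge0 // divr_ge0.
apply: (@le_trans _ _ (\sum_(P <- throughs x t)
   (A0 < t)%:R * ((2 / 3) ^+ t / (24 * t%:R) * num S * 4 ^- path_weight P))); last first.
  rewrite -mulr_sumr -[leRHS]mulrA; apply: ler_wpM2l; rewrite ?ler0n // -mulr_sumr.
  apply: (@le_trans _ _ ((2 / 3) ^+ t / (24 * t%:R) * num S * (8 * t%:R))).
    by rewrite ler_wpM2l ?sum_throughs // !mulr_ge0 ?num_ge0 // invr_ge0 mulr_ge0 // ltW.
  rewrite le_eqVlt; apply/orP; left; apply/eqP; field.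
  by rewrite lt0r_neq0.
have nn P : 0 <= (A0 < t)%:R * ((2 / 3) ^+ t / (24 * t%:R) * num S * 4 ^- path_weight P).
  by rewrite !mulr_ge0 ?ler0n ?num_ge0 ?invr_ge0 ?exprn_ge0 ?mulr_ge0 ?ler0n.
rewrite big_mkcond /= big_seq [leRHS]big_seq; apply: ler_sum => P /(throughsP t0)[sP xP].
case: ifP => [/and4P[uP soP /allP PS hP]|_]; last exact: nn.
have pP : is_path P by split.
have [ex|all] := pselect (exists2 v, branch D v \in P & (t <= rad v)%N).
  by case: ex => v vP tv; rewrite (bad_short SB xB pP PS sP vP tv).
have lP v : branch D v \in P -> (rad v < t)%N.
  by move=> vP; rewrite ltnNge; apply/negP => tv; apply: all; exists v.
have [v vP Av] := hA P pP PS xP hP.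
rewrite (leq_ltn_trans Av (lP v vP)) mul1r.
exact: (minor_bad gb SB Sn pP PS sP hP lP).
Qed.

(** * Repetitions inside an edge, and the growth of the number of colourings *)

Lemma count_all S x v w a m : adj v w -> (0 < a)%N -> (a + m <= (len v w).+1)%N ->
  x \notin seg v w a m -> {subset seg v w a m <= (x |: S) :|: Br} ->
  count (mem S) (seg v w a m) = m.
Proof.
move=> vw a0 al xs sub; rewrite -[RHS](size_seg v w a m); apply/eqP; rewrite -all_count.
apply/allP => y ys; have := sub y ys; rewrite in_setU in_setU1.
rewrite (negbTE (seg_inner vw a0 al ys)) orbF => /predU1P[yx|//].
by rewrite -yx ys in xs.
Qed.

(** A repetition inside one edge: uncolour the window of [t] vertices starting at
    [a].  Since the vertex at [j] is uncoloured in [S], the window can be peeled off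
    on both of its sides. *)
Lemma window_bad n S v w i j t a (r : R) : growth_below n -> [disjoint S & Br] -> (#|S| <= n)%N ->
  adj v w -> vtx v w j \notin S -> (0 < i)%N -> (i + t.*2 <= (len v w).+1)%N ->
  (i <= a)%N -> (a + t <= i + t.*2)%N -> (a <= j < a + t)%N -> (j + rad w <= len v w)%N ->
  (rad v <= j)%N || (a + t == j.+1)%N -> 1 <= r ->
  (forall k, (a <= k)%N -> r <= growth v k) ->
  (forall k, ((len v w).+2 - (a + t) <= k)%N -> r <= growth w k) ->
  {subset seg v w i t.*2 <= (vtx v w j |: S) :|: Br} ->
  r ^+ t.-1 * #|bad S (vtx v w j) (seg v w i t.*2)|%:R <= num S.
Proof.
move=> gb SB Sn vw jS i0 il ia ai aj jw jv r1 rv rw PS.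
(* [m1] and [m2] vertices of the window lie before and after [j]; the latter start
   at [b] when read from the other end of the edge *)
pose m1 := (j - a)%N; pose m2 := (a + t - j.+1)%N; pose b := ((len v w).+2 - (a + t))%N.
have lw := len_sym vw; have wv : adj w v by rewrite adj_sym.
have [h1 h2 h3 h4 h5] : [/\ (0 < a)%N, (a + m1 = j)%N, t = (m1 + (1 + m2))%N,
   (b + m2 <= (len v w).+1)%N & ((len v w).+1 - (b + m2) = j)%N].
  by rewrite /m1 /m2 /b; split; lia.
have [k1 k2 k3 k4 k5] : [/\ (j <= len v w)%N, (j + rad w <= (len v w).+1)%N, (0 < b)%N,
   (j.+1 + m2 <= (len v w).+1)%N & ((len v w).+2 - (j.+1 + m2) = b)%N].
  by rewrite /m1 /m2 /b; split; lia.
have [k6 k7 k8] : [/\ (a + m1 <= (len v w).+1)%N, (a + t <= (len v w).+2)%N & (i + t.*2 <= (len v w).+2)%N].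
  by split; lia.
have k9 : (b + m2 <= len w v)%N by rewrite lw /b /m2; lia.
have k10 : (rad v <= j)%N -> (b + m2 + rad v <= (len w v).+1)%N by rewrite lw /b /m2; lia.
have ew : seg v w a t = seg v w a m1 ++ vtx v w j :: seg v w j.+1 m2.
  by rewrite h3 seg_cat h2.
have inj k : (k <= (len v w).+1)%N -> vtx v w j = vtx v w k -> j = k.
  by move=> kl; apply: vtx_inj => //; lia.
have n1 : vtx v w j \notin seg v w a m1.
  by apply/negP => /mem_seg[k kl /inj]; lia.
have n2 : vtx v w j \notin seg v w j.+1 m2.
  by apply/negP => /mem_seg[k kl /inj]; lia.
have wP : {subset seg v w a t <= seg v w i t.*2}.
  by move=> y /mem_seg[k kl ->]; apply/mem_seg; exists k => //; lia.
have uw : uniq (seg v w a t) by apply: uniq_seg.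
have s1 : {subset seg v w a m1 <= (vtx v w j |: S) :|: Br}.
  by move=> y y1; apply/PS/wP; rewrite ew mem_cat y1.
have s2 : {subset seg v w j.+1 m2 <= (vtx v w j |: S) :|: Br}.
  by move=> y y2; apply/PS/wP; rewrite ew mem_cat inE y2 !orbT.
have c1 := count_all vw h1 k6 n1 s1; have c2 := count_all vw (ltn0Sn j) k4 n2 s2.
have tr := seg_transversal vw k8 k7.
have jU : vtx v w j \in [set z in seg v w a t] by rewrite inE ew mem_cat inE eqxx orbT.
have sU : {subset [set z in seg v w a t] <= seg v w i t.*2} by move=> y; rewrite inE => /wP.
have hb := card_bad f_inj allowed SB sU PS tr jU.
have eU : S :\: [set z in seg v w a t] = uncol (uncol S (seg v w a m1)) (seg v w j.+1 m2).
  by rewrite -[LHS]/(uncol S _) ew -cat_rcons uncol_cat uncol_rcons setD1_notin.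
set S2 := uncol S (seg v w a m1) in eU.
have S2B : [disjoint S2 & Br] := disjoint_setD _ SB.
have S2n : (#|S2| <= n)%N by apply: leq_trans Sn; exact: card_uncol.
have jS2 : vtx v w j \notin S2 by rewrite inE negb_and jS orbT.
have c2' : count (mem S2) (seg v w j.+1 m2) = m2.
  rewrite -[RHS]c2; apply: eq_in_count => y y2; rewrite /= inE.
  suff -> : y \notin [set z in seg v w a m1] by [].
  rewrite inE; apply/negP => y1; move: uw; rewrite ew cat_uniq => /and3P[_ /hasPn/(_ y)].
  by rewrite inE y2 orbT /= => /(_ isT); rewrite y1.
have le1 : r ^+ m1 * num S2 <= num S.
  by rewrite -[X in r ^+ X]c1; apply: (peel gb SB Sn vw h1 _ _ _ r1 rv); rewrite h2.
have le2 : r ^+ m2 * num (uncol S2 (seg v w j.+1 m2)) <= num S2.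
  case/orP: jv => [vj|/eqP ea]; last first.
    have -> : m2 = 0%N by rewrite /m2 ea subnn.
    by rewrite expr0 mul1r uncol_nil.
  rewrite -[X in r ^+ X]c2' -(count_rev _ (seg v w j.+1 m2)).
  rewrite (uncol_eq _ (fun y => esym (mem_rev _ y))) (rev_seg vw) ?k5; last by rewrite leqW.
  apply: (peel gb S2B S2n wv k3 k9 (k10 vj) _ r1 rw).
  by rewrite (vtx_sym vw h4) h5.
have -> : t.-1 = (m1 + m2)%N by rewrite h3 add1n addnS.
rewrite exprD -mulrA; apply: le_trans le1; rewrite ler_wpM2l ?exprn_ge0 ?(le_trans _ r1) //.
apply: le_trans le2; rewrite ler_wpM2l ?exprn_ge0 ?(le_trans _ r1) //.
by rewrite -eU ler_nat.
Qed.

(** One step of the induction: the list of colours of [x], less the cost [M] of the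
    repetitions inside the edge of [x], which [main] enumerates, and the cost of
    those through branch vertices. *)
Lemma growth_step n S x (A0 : nat) (main : seq (seq G)) (M : R) : growth_below n ->
  [disjoint S & Br] -> (#|S| <= n)%N -> x \notin Br -> x \notin S ->
  (forall P, is_path P -> {subset P <= (x |: S) :|: Br} -> x \in P -> has (mem Br) P ->
     exists2 v, branch D v \in P & (A0 <= rad v)%N) ->
  (forall P t, is_path P -> {subset P <= (x |: S) :|: Br} -> x \in P -> (0 < t)%N ->
     size P = t.*2 -> (forall y, y \in P -> y \notin Br) -> (P \in main) || (rev P \in main)) ->
  \sum_(P <- main | all (mem ((x |: S) :|: Br)) P) #|bad S x P|%:R <= M * num S ->
  (#|allowed x|%:R - M - (2 / 3) ^+ A0.+1) * num S <= num (x |: S).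
Proof.
move=> gb SB Sn xB xS hA hmain hM.
have := sum_minors gb SB Sn xB hA.
pose F := [seq P <- main | all (mem ((x |: S) :|: Br)) P] ++ minors S x.
have := @card_good_step _ _ f allowed Br S x F xS _ => step.
have {}step : (#|allowed x| * #|good f allowed Br S| <= #|good f allowed Br (x |: S)| +
    \sum_(P <- F) #|bad S x P|)%N.
  apply: step => c P _ pP PS xP [t [t0 sP _]].
  have [hB|nB] := boolP (has (mem Br) P).
    by rewrite mem_cat (mem_minors pP xP sP t0 PS hB) !orbT.
  have nB' y : y \in P -> y \notin Br by move=> yP; exact: (hasPn nB y yP).
  have aP : all (mem ((x |: S) :|: Br)) P by apply/allP.
  rewrite !mem_cat !mem_filter all_rev aP /=.
  by case/orP: (hmain P t pP PS xP t0 sP nB') => ->; rewrite ?orbT.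
move: step; rewrite -(ler_nat R) natrM natrD big_cat natrD [in X in _ + (X + _)]big_filter [in X in _ + (X + _)]natr_sum.
rewrite -/(num S) -/(num (x |: S)) => step mn.
rewrite !mulrBl; lra.
Qed.

Lemma sum_half h : \sum_(t <- iota 1 h) 2 ^- t.-1 = 2 - 2 * 2 ^- h :> R.
Proof.
elim: h => [|h IH]; first by rewrite big_nil expr0; lra.
rewrite -(addn1 h) iotaD big_cat /= big_seq1 IH addn1 add1n /=.
rewrite [2 ^+ h.+1]exprS invfM; lra.
Qed.

(** A path through a tip [x] ends there, so there is one path per length inside the
    edge.  Near [v] only those of half-length at most [j./2] fit between [x] and [v];
    the missing terms of the series pay for the paths through [v]. *)
Lemma tip_step n S : growth_below n -> [disjoint S & Br] -> (#|S| <= n)%N -> tip_growth S.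
Proof.
move=> gb SB Sn v w j vw jl jw xS yS; set x := vtx v w j in xS *; set y := vtx v w j.+1 in yS.
have [jl' yl] : (0 < j <= len v w)%N /\ (0 < j.+1 <= len v w)%N by split; lia.
have xB := vtx_inner vw jl'; have yB := vtx_inner vw yl.
have yx : y != x by apply/eqP => /(vtx_inj vw); lia.
have yN P : {subset P <= (x |: S) :|: Br} -> y \notin P.
  move=> PS; apply/negP => /PS; rewrite in_setU in_setU1.
  by rewrite (negbTE yx) (negbTE yS) (negbTE yB).
pose main := [seq seg v w (j.+1 - t.*2) t.*2 | t <- iota 1 j./2].
have hmain P t : is_path P -> {subset P <= (x |: S) :|: Br} -> x \in P -> (0 < t)%N ->
     size P = t.*2 -> (forall y, y \in P -> y \notin Br) -> (P \in main) || (rev P \in main).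
  move=> pP PS xP t0 sP nP.
  have [i [i0 il ij es]] := path_in_edge vw jl' pP nP xP; rewrite sP in il ij es.
  have ny : y \notin seg v w i t.*2 by case: es => <-; rewrite ?mem_rev yN.
  have e : (i + t.*2 = j.+1)%N.
    apply/eqP; rewrite eqn_leq; case/andP: ij => ij ->; rewrite andbT leqNgt.
    apply: contra ny => lt; apply/mem_seg; exists j.+1 => //; clear - ij lt; lia.
  have im : seg v w i t.*2 \in main.
    by apply/mapP; exists t; [rewrite mem_iota|congr seg]; clear - e i0 t0; lia.
  by case: es => ->; rewrite im ?orbT.
pose h := j./2.
have hM : \sum_(P <- main | all (mem ((x |: S) :|: Br)) P) #|bad S x P|%:R <=
    (2 - 2 * 2 ^- h) * num S.
  rewrite -sum_half mulr_suml big_map big_mkcond /= big_seq [leRHS]big_seq.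
  apply: ler_sum => t; rewrite mem_iota => tl.
  case: ifP => [/allP PS|_]; last by rewrite mulr_ge0 ?num_ge0 ?invr_ge0 ?exprn_ge0.
  rewrite mulrC ler_pdivlMr ?exprn_gt0 // mulrC.
  have [f0 f1 f2] : [/\ (0 < j.+1 - t.*2)%N, (j.+1 - t.*2 + t.*2 <= (len v w).+1)%N &
      (j.+1 - t.*2 <= j.+1 - t)%N] by clear - tl jl; split; lia.
  have [f3 f4 f5] : [/\ (j.+1 - t + t <= j.+1 - t.*2 + t.*2)%N, (j.+1 - t <= j < j.+1 - t + t)%N &
      (j.+1 - t + t == j.+1)%N] by clear - tl jl; split; lia.
  have f6 : (rad v <= j)%N || (j.+1 - t + t == j.+1)%N by rewrite f5 orbT.
  have r1 : 1 <= 2 :> R by rewrite ler1n.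
  exact: (window_bad gb SB Sn vw xS f0 f1 f2 f3 f4 jw f6 r1 (fun k _ => growth_ge2 _ k)
    (fun k _ => growth_ge2 _ k) PS).
have reach P : is_path P -> {subset P <= (x |: S) :|: Br} -> x \in P -> has (mem Br) P ->
    branch D v \in P.
  move=> pP PS xP hP; have [u [w' [s [uw sl ex uP kP]]]] := reach_branch pP xP xB hP.
  have sl' : (s <= (len u w').+1)%N by case/andP: sl => _ /leqW.
  have [[eu _ _]|[eu ew es]] := vtx_eq vw uw jl' sl' ex; first by rewrite -eu.
  subst u w'; have /negP[] := yN P PS.
  have [y1 y2] : (0 < (len v w).+1 - j.+1 <= s)%N /\ (j.+1 <= (len v w).+1)%N.
    by rewrite es; clear - jl; split; lia.
  by rewrite /y (vtx_rev vw y2); exact: kP.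
have grow A0 hA := growth_step (A0 := A0) gb SB Sn xB xS hA hmain hM.
have n0 := num_ge0 S.
have h2 : 2 ^- h > 0 :> R by rewrite invr_gt0 exprn_gt0.
rewrite /growth; case: ifP => jr.
  apply: le_trans (grow (rad v) _); last by move=> P pP PS xP hP; exists v => //; exact: reach.
  rewrite ler_wpM2r //.
  have al4 : 4 <= #|allowed x|%:R :> R by rewrite ler_nat; exact: card_allowed.
  have : (2 / 3) ^+ (rad v).+1 <= 2 ^- h :> R.
    apply: pow23_half; rewrite /h; clear - jr; lia.
  lra.
have fx : far x by rewrite /x (far_vtx vw jl') jw andbT ltnNge jr.
apply: le_trans (grow 200%N _).
  rewrite ler_wpM2r // (card_allowed_far fx).
  have := pow23 R; lra.
move=> P pP PS xP /hasP[z zP /BrP[u zu]]; exists u; first by rewrite -zu.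
by rewrite /rad leq_pmulr.
Qed.

(** The windows of at most eight vertices around a deep vertex are far. *)
Definition deep v w j := (rad v + 8 < j)%N && (j + rad w + 8 <= len v w)%N.

(** Both neighbours may be coloured, so all intervals around the vertex count; by
    [sum_windows] they spoil at most 241/50 of the five colours. *)
Lemma deep_step n S v w j : growth_below n -> [disjoint S & Br] -> (#|S| <= n)%N ->
  adj v w -> deep v w j -> vtx v w j \notin S -> num S <= 10 * num (vtx v w j |: S).
Proof.
move=> gb SB Sn vw /andP[dv dw] xS; set x := vtx v w j in xS *.
have [jl jw vj] : [/\ (0 < j <= len v w)%N, (j + rad w <= len v w)%N & (rad v <= j)%N].
  by clear - dv dw; split; lia.
have xB := vtx_inner vw jl.
pose good_start t i := (0 < i <= j)%N && (i + t.*2 <= (len v w).+1)%N.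
pose starts t := [seq i <- iota (j.+1 - t.*2) t.*2 | good_start t i].
(* half-lengths up to [#|G|] suffice; the summand 8 is there to match [sum_windows] *)
pose main := flatten [seq [seq seg v w i t.*2 | i <- starts t] | t <- iota 1 (8 + #|G|)].
have hmain P t : is_path P -> {subset P <= (x |: S) :|: Br} -> x \in P -> (0 < t)%N ->
     size P = t.*2 -> (forall y, y \in P -> y \notin Br) -> (P \in main) || (rev P \in main).
  move=> pP PS xP t0 sP nP.
  have tG : (t < 1 + (8 + #|G|))%N.
    have := max_card (mem P); case: (pP) => uP _; rewrite (card_uniqP uP) sP => tG.
    apply: (@leq_trans (1 + #|G|)%N); last by rewrite leq_add2l leq_addl.
    by rewrite add1n ltnS; apply: leq_trans tG; rewrite -addnn leq_addr.
  have [i [i0 il ij es]] := path_in_edge vw jl pP nP xP; rewrite sP in il ij es.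
  have im : seg v w i t.*2 \in main.
    apply/flatten_mapP; exists t; first by rewrite mem_iota t0.
    apply: map_f; rewrite mem_filter /good_start i0 il andbT mem_iota.
    by clear - ij t0; lia.
  by case: es => ->; rewrite im ?orbT.
have hM : \sum_(P <- main | all (mem ((x |: S) :|: Br)) P) #|bad S x P|%:R <=
    241 / 50 * num S.
  rewrite big_flatten big_map.
  apply: (@le_trans _ _ (\sum_(t <- iota 1 (8 + #|G|)) t.*2%:R * window_rate R t ^- t.-1 * num S));
    last by rewrite -mulr_suml ler_wpM2r ?num_ge0 // sum_windows.
  rewrite big_seq [leRHS]big_seq; apply: ler_sum => t; rewrite mem_iota => /andP[t0 _].
  have rt0 := window_rate_gt0 R t.
  have c0 : 0 <= window_rate R t ^- t.-1 * num S.
    by rewrite mulr_ge0 ?num_ge0 // invr_ge0 exprn_ge0 // ltW.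
  apply: (@le_trans _ _ (\sum_(i <- starts t) window_rate R t ^- t.-1 * num S)); last first.
    rewrite big_const_seq count_predT iter_addr_0 -[leLHS]mulr_natl -mulrA ler_wpM2r // ler_nat.
    by rewrite size_filter; apply: leq_trans (count_size _ _) _; rewrite size_iota.
  rewrite big_map big_mkcond /= big_seq [leRHS]big_seq; apply: ler_sum => i.
  rewrite mem_filter mem_iota => /andP[/andP[/andP[i0 ij] il] /andP[ji _]].
  case: ifP => [/allP PS|_]; last exact: c0.
  rewrite mulrC ler_pdivlMr ?exprn_gt0 // mulrC.
  (* the window ends at [j] if there is room for it on the left, and otherwise
     starts with the path *)
  pose a := maxn i (j.+1 - t).
  have [f1 f2 f3] : [/\ (i <= a)%N, (a + t <= i + t.*2)%N & (a <= j < a + t)%N].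
    by rewrite /a; clear - ij ji t0; split; lia.
  have r1 : 1 <= window_rate R t.
    by rewrite /window_rate; case: ifP => _; lra.
  have vj' : (rad v <= j)%N || (a + t == j.+1)%N by rewrite vj.
  have rv k : (a <= k)%N -> window_rate R t <= growth v k.
    move=> ak; rewrite /window_rate /growth; case: leqP => t8; last by case: ifP => _; lra.
    have ki : (rad v < k)%N by move: ak; rewrite /a; clear - t8 dv; lia.
    by rewrite leqNgt ki.
  have rw k : ((len v w).+2 - (a + t) <= k)%N -> window_rate R t <= growth w k.
    move=> ak; rewrite /window_rate /growth; case: leqP => t8; last by case: ifP => _; lra.
    have ki : (rad w < k)%N by move: ak f3; clear - t8 dw; lia.
    by rewrite leqNgt ki.
  exact: (window_bad gb SB Sn vw xS i0 il f1 f2 f3 jw vj' r1 rv rw PS).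
have fx : far x by rewrite /x (far_vtx vw jl) jw andbT; clear - dv; lia.
have := growth_step (A0 := 200) gb SB Sn xB xS _ hmain hM.
rewrite (card_allowed_far fx) => step.
have {}step : (5 - 241 / 50 - (2 / 3) ^+ 201) * num S <= num (x |: S).
  apply: step => P pP PS xP /hasP[z zP /BrP[u zu]]; exists u; first by rewrite -zu.
  by rewrite /rad leq_pmulr.
have n0 := num_ge0 S; have p := pow23 R.
have : (1 / 10) * num S <= num (x |: S).
  by apply: le_trans step; rewrite ler_wpM2r //; lra.
by lra.
Qed.

(** A far vertex close to [rad v]: uncolour the next vertex outwards (at most five
    colourings merge), colour the given one as a tip, and put the next one back by
    induction.  At most eight such steps lead to a deep vertex. *)
Lemma far_descent n v w : growth_below n -> adj v w ->
  forall m j S, [disjoint S & Br] -> (#|S| <= n)%N ->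
  (rad v < j)%N -> (j + m = rad v + 9)%N -> vtx v w j \notin S ->
  num S <= 10 * (50 / 29) ^+ m * num (vtx v w j |: S).
Proof.
move=> gb vw; have lg := long vw; have lw0 := lam_gt0 w; have lv0 := lam_gt0 v.
elim=> [|m IH] j S SB Sn vj jm xS.
  rewrite expr0 mulr1; apply: (deep_step gb) => //; rewrite /deep; move: lg jm.
  by rewrite /rad; clear - lw0 lv0; lia.
have [j1 j2 j3] : [/\ (0 < j < len v w)%N, (j + rad w <= len v w)%N & (j.+1 + m = rad v + 9)%N].
  by move: lg jm; rewrite /rad; clear - lw0 lv0 vj; split; lia.
have [i1 i2] : (0 < j <= len v w)%N /\ (0 < j.+1 <= len v w)%N by clear - j1; split; lia.
have xB := vtx_inner vw i1; have yB := vtx_inner vw i2.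
have gj : growth v j = 29 / 10 by rewrite /growth leqNgt vj.
have xy : vtx v w j.+1 != vtx v w j by apply/eqP => /(vtx_inj vw); clear - j1; lia.
have n0 := num_ge0; have e1 : 1 <= (50 / 29) ^+ m :> R by apply: exprn_ege1; lra.
have [yS|yS] := boolP (vtx v w j.+1 \in S); last first.
  have := tip_step gb SB Sn vw j1 j2 xS yS; rewrite gj => t1.
  apply: (@le_trans _ _ (1 * num (vtx v w j |: S))).
    by have := n0 S; move: t1; lra.
  rewrite ler_wpM2r // exprS; move: e1; lra.
pose S1 := S :\ vtx v w j.+1.
have S1B : [disjoint S1 & Br] := disjoint_setD _ SB.
have xS1 : vtx v w j \notin S1 by rewrite inE negb_and xS orbT.
have yS1 : vtx v w j.+1 \notin S1 by rewrite !inE eqxx.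
have S1n : (#|S1| < n)%N by apply: leq_trans Sn; exact: card_setD1_lt.
have S2B : [disjoint vtx v w j |: S1 & Br].
  rewrite disjoints_subset subUset sub1set inE xB -disjoints_subset; exact: S1B.
have S2n : (#|vtx v w j |: S1| <= n)%N by rewrite cardsU1 xS1.
have yS2 : vtx v w j.+1 \notin vtx v w j |: S1 by rewrite in_setU1 (negbTE xy) (negbTE yS1).
have := IH _ _ S2B S2n (leqW vj) j3 yS2.
have -> : vtx v w j.+1 |: (vtx v w j |: S1) = vtx v w j |: S.
  by rewrite setUCA setD1K.
have [tg _] := gb S1 S1B S1n.
have := tg v w j vw j1 j2 xS1 yS1; rewrite gj.
have : num S <= 5 * num S1.
  by rewrite /num -natrM ler_nat; exact: card_good_le5.
set A := num S; set B := num S1; set B2 := num _; set N := num _; set e := _ ^+ m.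
rewrite exprS -/e; move: {e1 IH} e => e; lra.
Qed.

Lemma far_step n S : growth_below n -> [disjoint S & Br] -> (#|S| <= n)%N -> far_growth S.
Proof.
move=> gb SB Sn x fx xS; have xB : x \notin Br by case/andP: fx.
have [v [w [j [vw jl ex]]]] := vertexE xB; subst x.
have n0 := num_ge0 (vtx v w j |: S).
move: (fx); rewrite (far_vtx vw jl) => /andP[vj jw].
have desc m u u' i : adj u u' -> (m <= 8)%N -> (rad u < i)%N -> (i + m = rad u + 9)%N ->
   vtx v w j = vtx u u' i -> num S <= 2 ^+ 10 * num (vtx v w j |: S).
  move=> uu m8 ui im e; have := far_descent gb uu SB Sn ui im; rewrite -e => /(_ xS) h.
  by apply: (le_trans h); rewrite ler_wpM2r // far_rate.
have [d1|d1] := leqP (rad v + 9) j; last first.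
  by apply: (desc (rad v + 9 - j)%N v w j) => //; clear - d1 vj; lia.
have [d2|d2] := leqP (j + rad w + 8) (len v w); last first.
  have wv : adj w v by rewrite adj_sym.
  apply: (desc (rad w + 9 - ((len v w).+1 - j))%N w v ((len v w).+1 - j)%N) => //.
  - by clear - d2 jl jw; lia.
  - by clear - d2 jl jw; lia.
  - by clear - d2 jl jw; lia.
  - by apply: (vtx_rev vw); clear - jl; lia.
apply: (le_trans (deep_step gb SB Sn vw _ xS)); first by rewrite /deep d2 andbT; clear - d1; lia.
rewrite ler_wpM2r //.
by have := far_rate R (leq0n 8); rewrite expr0 mulr1.
Qed.

Lemma growth_all n : growth_below n.
Proof.
elim: n => // n IH S SB Sn; split; first exact: (tip_step IH SB Sn).
exact: (far_step IH SB Sn).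
Qed.

Lemma good0 : [ffun=> ord0] \in good f allowed Br set0.
Proof.
apply/goodP; split=> [x _|x|p pP pB]; first by rewrite ffunE.
  by rewrite inE.
move=> [t [t0 sp _]]; case: p pP pB sp => [|x [|y p]] [_ /= pp] pB; [lia|lia|].
have bx z : z \in [:: x, y & p] -> z \in Br by move=> /pB; rewrite set0U.
have /BrP[v xv] : x \in Br by apply: bx; rewrite inE eqxx.
case/andP: pp; rewrite xv => /nbr_branch[w [vw yw]] _.
have : y \in Br by apply: bx; rewrite !inE eqxx orbT.
have l1 : (0 < 1 <= len v w)%N by rewrite (len_gt0 vw).
by rewrite yw (negbTE (vtx_inner vw l1)).
Qed.

(** Uncolour the far vertices first, in any order, and then the near ones, farthest
    from their branch vertex first, so that each is a tip. *)
Lemma num_gt0 S : [disjoint S & Br] -> 0 < num S.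
Proof.
have [m] := ubnP #|S|; elim: m S => // m IH S; rewrite ltnS => Sm SB.
have gb := @growth_all #|S|.
have lt z : z \in S -> 0 < num (S :\ z).
  by move=> zS; apply: IH; [apply: leq_trans Sm; exact: card_setD1_lt|exact: disjoint_setD].
have [->|[z zS]] := set_0Vmem S.
  by rewrite /num ltr0n; apply/card_gt0P; exists [ffun=> ord0]; exact: good0.
have [/existsP[y /andP[yS fy]]|/existsPn nf] := boolP [exists y, (y \in S) && far y].
  have := far_num gb SB (leqnn _) fy; have := lt y yS; have p : 0 < 2 ^+ 10 :> R by rewrite exprn_gt0.
  by move=> h1 h2; rewrite -(pmulr_rgt0 _ p); exact: lt_le_trans h1 h2.
have zB : z \notin Br by apply/negP => zB; have := disjointFr SB zS; rewrite zB.
have : ~~ far z by have := nf z; rewrite zS.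
rewrite /far zB /= negbK => /existsP[v /existsP[w /andP[vw /mem_seg[k kl ek]]]].
pose P i := (0 < i <= rad v)%N && (vtx v w i \in S).
have exP : exists i, P i by exists k; rewrite /P -ek zS andbT; clear - kl; lia.
have ubP i : P i -> (i <= rad v)%N by case/andP => /andP[].
case: (ex_maxnP exP ubP) => j /andP[jl jS] jmax.
have [j1 j2 j3] : [/\ (0 < j < len v w)%N, (j + rad w <= len v w)%N & (j.+1 + rad w <= len v w)%N].
  by have := long vw; move: jl (lam_gt0 v) (lam_gt0 w); rewrite /rad; clear; split; lia.
have yS : vtx v w j.+1 \notin S.
  apply/negP => yS; have [jr|jr] := leqP j.+1 (rad v).
    by have := jmax j.+1; rewrite /P jr yS ltnn => /(_ isT).
  have l1 : (0 < j.+1 <= len v w)%N by clear - j1; lia.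
  by have := nf (vtx v w j.+1); rewrite yS (far_vtx vw l1) jr j3.
have [tg _] := gb (S :\ vtx v w j) (disjoint_setD _ SB) (card_setD1_lt jS).
have xS' : vtx v w j \notin S :\ vtx v w j by rewrite !inE eqxx.
have yS' : vtx v w j.+1 \notin S :\ vtx v w j by rewrite inE negb_and yS orbT.
have := tg v w j vw j1 j2 xS' yS'; rewrite setD1K //; apply: lt_le_trans.
by rewrite mulr_gt0 ?lt //; apply: lt_le_trans (growth_ge2 _ _); rewrite ltr0n.
Qed.

End Subdivision.

(** * The theorem *)

Section Choosable.

Variables (H G : sgraph) (D : subdivision H G) (lam : H -> nat).
Hypothesis lam_gt0 : forall v, 0 < lam v.
Hypothesis edges_long : forall v w, adj v w -> stretch * (lam v + lam w) <= len D v w.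
Hypothesis deg_lam : forall v, deg v <= 4 ^ lam v.

Lemma subdivision_choosable : nonrep_choosable G 5.
Proof.
move=> C L hL.
have /choice[f fP] x : exists g : 'I_5 -> C, injective g /\ forall i, L x (g i).
  by have [g gi gL] := card_le_ord_inj (hL x); exists g.
have fi x : injective (f x) by case: (fP x).
have dis : [disjoint ~: Br D & Br D] by rewrite -setI_eq0 setIC setICr.
have := num_gt0 lam_gt0 edges_long deg_lam fi rat dis.
rewrite /num ltr0n => /card_gt0P[c /goodP[_ _ cn]].
exists (paint f c); split=> [v|p pp rp]; first exact: (fP v).2.
by apply: (cn p pp) rp => x _; rewrite setUC setUCr inE.
Qed.

End Choosable.

(** The maximum makes this positive at isolated vertices, too. *)
Definition level (H : sgraph) (v : H) : nat := maxn 1 (trunc_log 2 (deg v).+1).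

Lemma deg_level (H : sgraph) (v : H) : deg v <= 4 ^ level v.
Proof.
have /andP[_ h] := trunc_log_bounds (isT : 1 < 2) (ltn0Sn (deg v)).
apply: ltnW; apply: ltn_trans (ltnSn _) (leq_trans h _).
rewrite -[4]/(2 ^ 2) -expnM leq_exp2l // /level; lia.
Qed.

Lemma level_log2 (R : realType) (H : sgraph) (v w : H) : adj v w ->
  ((level v)%:R <= log2 ((deg v)%:R + 1) :> R)%R.
Proof.
move=> vw; have d0 : 0 < deg v by apply/card_gt0P; exists w; rewrite inE.
have tl : 0 < trunc_log 2 (deg v).+1 by rewrite trunc_log_gt0.
have -> : level v = trunc_log 2 (deg v).+1 by rewrite /level; lia.
have l2 : (0 < ln 2 :> R)%R by rewrite ln_gt0 // ltr1n.
have d1 : (0 < (deg v)%:R + 1 :> R)%R by rewrite natr1 ltr0n.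
have p1 : (0 < 2 ^+ trunc_log 2 (deg v).+1 :> R)%R by rewrite exprn_gt0 // ltr0n.
rewrite /log2 ler_pdivlMr // mulr_natl -lnXn ?ltr0n // ler_ln ?posrE //.
by rewrite natr1 -natrX ler_nat; exact: trunc_logP.
Qed.

Theorem theorem2 (R : realType) (H G : sgraph) (S : subdivision H G)
  (hS : forall v w : H, adj v w ->
    (Num.ceil (10 ^+ 5 * log2 ((deg v)%:R + 1) : R)
     + Num.ceil (10 ^+ 5 * log2 ((deg w)%:R + 1) : R) + 2
       <= (size (division S v w))%:Z)%R) :
  (pi_ch G <= 5)%N.
Proof.
have ch : nonrep_choosable G 5.
  apply: (@subdivision_choosable H G S (@level H)) => [v|v w vw|v].
  - by rewrite /level leq_maxl.
  - have wv : adj w v by rewrite adj_sym.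
    have key (u u' : H) : adj u u' ->
        ((stretch * level u)%:Z <= Num.ceil (10 ^+ 5 * log2 ((deg u)%:R + 1) : R))%R.
      move=> uu; rewrite -(ler_int R); apply: le_trans (ceil_ge _).
      rewrite -[leLHS]/((stretch * level u)%:R)%R natrM.
      have -> : (stretch%:R = 10 ^+ 5 :> R)%R by rewrite stretchE !exprS expr0 !natrM; ring.
      by rewrite ler_wpM2l ?exprn_ge0 // (level_log2 R uu).
    have := hS v w vw; have := key v w vw; have := key w v wv.
    rewrite /len mulnDr; lia.
  - exact: deg_level.
rewrite /pi_ch; case: ex_minnP => m _; apply; exact/asboolP.
Qed.
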